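(* Let $\alpha,\beta,\gamma\in\mathbb{N}$ with $\gamma=\alpha+\beta$, and consider the balanced triangular P\'olya urn with ball replacement matrix $\begin{pmatrix}\alpha&\beta\\0&\gamma\end{pmatrix}$, started with $w_0$ white and $b_0$ black balls. Let $W_n$ be the number of white balls after $n$ draws and $X_n=W_n/\alpha$. Then for every integer $s\ge1$, \[ \mathbb{E}\big(X_n^{\overline{s}}\big)=\frac{\Gamma\big(n+\frac{w_0+b_0+s\alpha}{\gamma}\big)\,\Gamma\big(\frac{w_0+b_0}{\gamma}\big)\,\Gamma\big(\frac{w_0}{\alpha}+s\big)}{\Gamma\big(\frac{w_0+b_0+s\alpha}{\gamma}\big)\,\Gamma\big(n+\frac{w_0+b_0}{\gamma}\big)\,\Gamma\big(\frac{w_0}{\alpha}\big)}. \] Moreover, let $\hat X_n=X_n-\frac{w_0}{\alpha}$ and $\lambda_{n,b_0}=\Big(\frac{n+b_0/\gamma}{b_0/\gamma}\Big)^{\alpha/\gamma}-1$. Then for $\min\{n,b_0\}\to\infty$ (where $b_0=b_0(n)$ may depend on $n$), for every $s\ge1$, \[ \mathbb{E}\big(\hat X_n^{\underline{s}}\big)=\lambda_{n,b_0}^s\,\frac{\Gamma(\frac{w_0}{\alpha}+s)}{\Gamma(\frac{w_0}{\alpha})}\,(1+o(1)). \] Let $X$ be Gamma distributed with shape $w_0/\alpha$ and scale $1$ (so $\mathbb{E}(X^s)=\Gamma(\frac{w_0}{\alpha}+s)/\Gamma(\frac{w_0}{\alpha})$). Then: (i) if $\lambda_{n,b_0}\to\infty$,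 $\hat X_n/\lambda_{n,b_0}$ converges in distribution, with convergence of all moments, to $X$; (ii) if $\lambda_{n,b_0}\to\rho\in(0,\infty)$, $\hat X_n$ converges in distribution, with convergence of all moments, to $Y\sim\mathrm{MPo}(\rho X)$.
   Context: In a P\'olya urn, at each step a ball is drawn uniformly at random and returned; if it is white, $\alpha$ white and $\beta$ black balls are added; if black, $\gamma$ black balls are added. $x^{\overline{s}}=x(x+1)\cdots(x+s-1)$ denotes the rising factorial and $x^{\underline{s}}=x(x-1)\cdots(x-s+1)$ the falling factorial. For a non-negative random variable $X$ and $\rho>0$, $Y\sim\mathrm{MPo}(\rho X)$ (mixed Poisson distribution with mixing distribution $X$ and scale parameter $\rho$) means $Y$ takes values in $\{0,1,2,\dots\}$ with $\mathbb{P}\{Y=\ell\}=\frac{\rho^\ell}{\ell!}\mathbb{E}(X^\ell e^{-\rho X})$. ''Convergence of all moments'' means convergence of all non-negative integer moments. *)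

(* Defs.v *)
From Stdlib Require Import Reals Factorial.
From Coquelicot Require Import Coquelicot.
Open Scope R_scope.

Fixpoint rising (x : R) (s : nat) : R :=
  match s with O => 1 | S s' => rising x s' * (x + INR s') end.

Fixpoint falling (x : R) (s : nat) : R :=
  match s with O => 1 | S s' => falling x s' * (x - INR s') end.

Definition Gamma (a : R) : R :=
  RInt_gen (fun t => Rpower t (a - 1) * exp (- t))
           (at_right 0) (Rbar_locally p_infty).

Definition gamma_density (a x : R) : R :=
  Rpower x (a - 1) * exp (- x) / Gamma a.

Definition gamma_cdf (a x : R) : R :=
  if Rle_dec x 0 then 0
  else RInt_gen (gamma_density a) (at_right 0) (at_point x).

(* Law of the triangular Polya urn with replacement matrix ((al,be),(0,ga)),
   started with w0 white and b0 black balls.  [urn_law w0 b0 al ga n k] is the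
   probability that exactly k of the first n draws are white, i.e. that
   W_n = w0 + al*k.  The total number of balls before draw n+1 is
   T_n = w0 + b0 + n*ga (the urn is balanced: ga = al + be); a white ball is
   drawn with probability W_n / T_n, in which case al white balls (and be black
   ones) are added, otherwise ga black balls are added. *)
Fixpoint urn_law (w0 b0 al ga : nat) (n k : nat) : R :=
  match n with
  | O => if Nat.eqb k 0 then 1 else 0
  | S n' =>
      let T := INR w0 + INR b0 + INR n' * INR ga in
      urn_law w0 b0 al ga n' k * (1 - (INR w0 + INR al * INR k) / T)
      + match k with
        | O => 0
        | S k' => urn_law w0 b0 al ga n' k' * ((INR w0 + INR al * INR k') / T)
        end
  end.

Definition Xval (w0 al k : nat) : R := (INR w0 + INR al * INR k) / INR al.

Definition urn_expect (w0 b0 al ga n : nat) (f : R -> R) : R :=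
  sum_f_R0 (fun k => urn_law w0 b0 al ga n k * f (Xval w0 al k)) n.

Definition urn_cdf (w0 b0 al ga n : nat) (f : R -> R) (x : R) : R :=
  urn_expect w0 b0 al ga n (fun y => if Rle_dec (f y) x then 1 else 0).

Definition lam (al ga n b0 : nat) : R :=
  Rpower ((INR n + INR b0 / INR ga) / (INR b0 / INR ga)) (INR al / INR ga) - 1.

Definition mpo_pmf (a rho : R) (l : nat) : R :=
  rho ^ l / INR (fact l) *
  RInt_gen (fun x => x ^ l * exp (- rho * x) * gamma_density a x)
           (at_right 0) (Rbar_locally p_infty).

Definition mpo_cdf (a rho x : R) : R :=
  Series (fun l => if Rle_dec (INR l) x then mpo_pmf a rho l else 0).

Definition conv_in_dist (Fn : nat -> R -> R) (F : R -> R) : Prop :=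
  forall x, continuity_pt F x -> is_lim_seq (fun n => Fn n x) (F x).

(* Main.v *)
Require Import Defs.
From Stdlib Require Import Reals.
From Coquelicot Require Import Coquelicot.
From Stdlib Require Import Factorial Lra Lia Psatz.
Open Scope R_scope.

(* In terms of the number k of white draws, W_n / al = a + k with a = w0 / al, and
   one draw is white with probability t_n (a + k), where t_n = al / T_n.

   Moments: the rising factorial moments are multiplied by 1 + s t_n at each step,
   which telescopes into Gamma quotients. The falling factorial moments of k, divided
   by a (a+1) ... (a+s-1), satisfy f_s(n+1) = f_s(n) + s t_n (f_s(n) + f_{s-1}(n)), as
   the powers of g_n = prod_{m<n} (1 + t_m) - 1 do up to second order terms in t_n;
   controlling these terms relatively to g_n^s gives f_s ~ g_n^s, and comparing
   1 + lam with products of the same shape gives g_n ~ lam.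

   Laws: replacing each draw by one step of a pure birth process with rates a + k
   costs O(t_n^2) in the generating function, uniformly in z, and the birth process
   is negative binomial. Hence E z^k = (1 + g_n (1 - z))^(-a) + O(1/b0). If lam
   converges, the coefficients converge to the negative binomial law, which is the
   Gamma-mixed Poisson law. If lam tends to infinity, the Laplace transform of k / lam
   converges to that of the Gamma law at every point, and distribution functions are
   squeezed between the polynomials 1 - (1 - y^m)^M in y = exp (- x). *)

(** * The urn recurrence *)

(** The difficulty is uniformity. The number b0 moves with n, and lam may tend to 0, to a positive
    number, to infinity, or to nothing at all, while the moments are claimed up to a factor 1 +
    o(1). An absolute error is therefore useless when g_n is small. The error of f_s is measured
    against t_0 g_n^(s-1) (1 + g_n); relative to g_n^s it is t_0 + t_0 / g_n, where t_0 <= al / b0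
    and t_0 / g_n <= 1/n + ga / b0. This is where both n and b0 have to tend to infinity. For the
    same reason g_n and lam are compared after 1 has been subtracted from the products, at the cost
    of a factor b0 / (b0 - c) that is free of n.

    For the laws, the birth process runs for the time ln (1 + t_n) in step n, so that the growth
    factors multiply to 1 + g_n. The rates a + k are unbounded, but z^k (1 - z)^2 is O(1/k^2) on
    [0,1], which makes the error of one step uniform in k and z. The errors add up to O(1/b0)
    because T_n grows by the constant ga, so that the sum of the 1 / T_n^2 is dominated by a
    telescoping one. As the bound is uniform in z, the point z may move with n, and the same
    estimate serves a fixed z and z = exp (- m / lam). *)

Lemma exp_opp_le1 (y : R) : 0 <= y -> exp (- y) <= 1.
Proof.
  intros Hy. rewrite exp_Ropp, <- Rinv_1. apply Rinv_le_contravar; [lra|].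
  pose proof (exp_ineq1_le y). lra.
Qed.

Definition urn_total (w0 b0 ga n : nat) : R := INR w0 + INR b0 + INR n * INR ga.

(* The [t_n] of the introduction: with [k] white draws so far, the next one is white
   with probability [white_rate w0 b0 al ga n * (w0 / al + k)]. *)
Definition white_rate (w0 b0 al ga n : nat) : R := INR al / urn_total w0 b0 ga n.

Definition draws_expect (w0 b0 al ga n : nat) (f : nat -> R) : R :=
  sum_f_R0 (fun k => urn_law w0 b0 al ga n k * f k) n.

Lemma urn_total_pos (w0 b0 ga n : nat) : (1 <= w0)%nat -> 0 < urn_total w0 b0 ga n.
Proof.
  intros H. unfold urn_total. apply le_INR in H. simpl in H.
  pose proof (pos_INR b0). pose proof (pos_INR ga). pose proof (pos_INR n). nra.
Qed.

Lemma urn_total_S (w0 b0 ga n : nat) :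
  urn_total w0 b0 ga (S n) = urn_total w0 b0 ga n + INR ga.
Proof. unfold urn_total. rewrite S_INR. ring. Qed.

Lemma urn_law_gt (w0 b0 al ga n k : nat) : (n < k)%nat -> urn_law w0 b0 al ga n k = 0.
Proof.
  revert k; induction n as [|n IH]; intros k Hk; simpl.
  - destruct (Nat.eqb_spec k 0); [lia | reflexivity].
  - rewrite IH by lia. destruct k as [|k]; [lia|]. rewrite IH by lia. ring.
Qed.

(** The factor 1 - W_n / T_n is non-negative only for k <= n, where al k <= ga n; for larger k the
    mass itself is 0. *)
Lemma urn_law_ge0 (w0 b0 al ga n k : nat) :
  (1 <= w0)%nat -> (al <= ga)%nat -> 0 <= urn_law w0 b0 al ga n k.
Proof.
  intros Hw Hag. revert k; induction n as [|n IH]; intros k.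
  - simpl. destruct (Nat.eqb k 0); lra.
  - pose proof (urn_total_pos w0 b0 ga n Hw) as HT. unfold urn_total in HT.
    assert (Hi : 0 <= / (INR w0 + INR b0 + INR n * INR ga))
      by (left; now apply Rinv_0_lt_compat).
    assert (Hk : forall j, 0 <= urn_law w0 b0 al ga n j *
               ((INR w0 + INR al * INR j) / (INR w0 + INR b0 + INR n * INR ga))).
    { intros j. apply Rmult_le_pos; [apply IH|]. apply Rmult_le_pos; [|exact Hi].
      pose proof (pos_INR w0); pose proof (pos_INR al); pose proof (pos_INR j); nra. }
    assert (Hl : 0 <= urn_law w0 b0 al ga n k *
               (1 - (INR w0 + INR al * INR k) / (INR w0 + INR b0 + INR n * INR ga))).
    { destruct (Nat.lt_ge_cases n k) as [Hn|Hn].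
      - rewrite urn_law_gt by assumption. lra.
      - apply Rmult_le_pos; [apply IH|].
        apply Rmult_le_reg_r with (1 := HT). rewrite Rmult_0_l.
        unfold Rdiv. rewrite Rmult_minus_distr_r, Rmult_assoc, Rinv_l by lra.
        apply le_INR in Hn, Hag.
        pose proof (pos_INR b0); pose proof (pos_INR al); pose proof (pos_INR k).
        assert (INR al * INR k <= INR ga * INR n) by (apply Rmult_le_compat; assumption).
        lra. }
    simpl. destruct k as [|k].
    + rewrite Rplus_0_r. exact Hl.
    + apply Rplus_le_le_0_compat; [exact Hl | apply Hk].
Qed.

Lemma draws_expect_ext (w0 b0 al ga n : nat) (f g : nat -> R) :
  (forall k, f k = g k) -> draws_expect w0 b0 al ga n f = draws_expect w0 b0 al ga n g.
Proof. intros H. apply sum_eq. intros k _. now rewrite H. Qed.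

Lemma draws_expect_lin (w0 b0 al ga n : nat) (c d : R) (f g : nat -> R) :
  draws_expect w0 b0 al ga n (fun k => c * f k + d * g k) =
  c * draws_expect w0 b0 al ga n f + d * draws_expect w0 b0 al ga n g.
Proof.
  unfold draws_expect. rewrite !scal_sum, <- plus_sum. apply sum_eq. intros; ring.
Qed.

Lemma draws_expect_scal (w0 b0 al ga n : nat) (c : R) (f : nat -> R) :
  draws_expect w0 b0 al ga n (fun k => c * f k) = c * draws_expect w0 b0 al ga n f.
Proof. unfold draws_expect. rewrite scal_sum. apply sum_eq. intros; ring. Qed.

Lemma draws_expect_le (w0 b0 al ga n : nat) (f g : nat -> R) :
  (1 <= w0)%nat -> (al <= ga)%nat -> (forall k, f k <= g k) ->
  draws_expect w0 b0 al ga n f <= draws_expect w0 b0 al ga n g.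
Proof.
  intros Hw Hag H. apply sum_Rle. intros k _.
  apply Rmult_le_compat_l; [now apply urn_law_ge0 | apply H].
Qed.

Lemma draws_expect_0 (w0 b0 al ga : nat) (f : nat -> R) :
  draws_expect w0 b0 al ga 0 f = f 0%nat.
Proof. unfold draws_expect. simpl. ring. Qed.

(** The transition operator of the Markov chain k, applied to a test function. The recurrences for
    moments and generating functions are obtained from it by choosing [f]. *)
Lemma draws_expect_S (w0 b0 al ga n : nat) (f : nat -> R) :
  draws_expect w0 b0 al ga (S n) f =
  draws_expect w0 b0 al ga n (fun k =>
    f k + (INR w0 + INR al * INR k) / urn_total w0 b0 ga n * (f (S k) - f k)).
Proof.
  unfold draws_expect, urn_total.
  set (T := INR w0 + INR b0 + INR n * INR ga).
  set (p := fun k => (INR w0 + INR al * INR k) / T).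
  transitivity
    (sum_f_R0 (fun k => urn_law w0 b0 al ga n k * (1 - p k) * f k) (S n)
     + sum_f_R0 (fun k => match k with
                          | O => 0
                          | S j => urn_law w0 b0 al ga n j * p j * f (S j)
                          end) (S n)).
  { rewrite <- plus_sum. apply sum_eq. intros k _. simpl. unfold p, T.
    destruct k; ring. }
  rewrite (decomp_sum (fun k => match k with O => 0 | S j => _ end)) by lia.
  (* In the first sum the term k = n + 1 vanishes, since n draws give at most n white ones; in the
     second sum it is the term k = 0 that vanishes. *)
  rewrite tech5, urn_law_gt by lia. simpl Nat.pred.
  rewrite !Rmult_0_l, Rplus_0_r, Rplus_0_l, <- plus_sum.
  apply sum_eq. intros k _. unfold p. ring.
Qed.

Lemma draws_expect_const (w0 b0 al ga n : nat) (c : R) :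
  draws_expect w0 b0 al ga n (fun _ => c) = c.
Proof.
  induction n as [|n IH]; [apply draws_expect_0|].
  rewrite draws_expect_S. etransitivity; [|exact IH]. apply draws_expect_ext. intros; ring.
Qed.

Lemma Xval_eq (w0 al k : nat) : (1 <= al)%nat -> Xval w0 al k = INR w0 / INR al + INR k.
Proof.
  intros H. apply le_INR in H. simpl in H. unfold Xval. field. lra.
Qed.

(** Both sides are the product of s + 1 consecutive factors from x on, with the first or the last
    factor split off. *)
Lemma rising_S (x : R) (s : nat) : x * rising (x + 1) s = rising x s * (x + INR s).
Proof.
  induction s as [|s IH]; [simpl; ring|].
  change (rising (x + 1) (S s)) with (rising (x + 1) s * (x + 1 + INR s)).
  change (rising x (S s)) with (rising x s * (x + INR s)).
  rewrite <- Rmult_assoc, IH, S_INR. ring.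
Qed.

Lemma falling_S (x : R) (s : nat) : falling x s * (x + 1) = falling (x + 1) s * (x + 1 - INR s).
Proof.
  induction s as [|s IH]; [simpl; ring|].
  change (falling (x + 1) (S s)) with (falling (x + 1) s * (x + 1 - INR s)).
  change (falling x (S s)) with (falling x s * (x - INR s)).
  rewrite <- IH, S_INR. ring.
Qed.

Lemma rising_pos (x : R) (s : nat) : 0 < x -> 0 < rising x s.
Proof.
  intros Hx. induction s as [|s IH]; simpl; [lra|].
  apply Rmult_lt_0_compat; [exact IH|]. pose proof (pos_INR s); lra.
Qed.

Lemma falling_diff (x : R) (s : nat) :
  falling (x + 1) (S s) - falling x (S s) = INR (S s) * falling x s.
Proof.
  change (falling (x + 1) (S s)) with (falling (x + 1) s * (x + 1 - INR s)).
  change (falling x (S s)) with (falling x s * (x - INR s)).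
  rewrite <- falling_S, S_INR. ring.
Qed.

(** Rising factorials are eigenfunctions of the transition operator: x times the increment of
    [rising] from x to x + 1 is s times [rising x s]. *)
Lemma draws_expect_rising_S (w0 b0 al ga n s : nat) :
  (1 <= al)%nat -> (1 <= w0)%nat ->
  draws_expect w0 b0 al ga (S n) (fun k => rising (Xval w0 al k) s) =
  (1 + INR s * white_rate w0 b0 al ga n) *
  draws_expect w0 b0 al ga n (fun k => rising (Xval w0 al k) s).
Proof.
  intros Hal Hw. rewrite draws_expect_S, <- draws_expect_scal.
  apply draws_expect_ext. intros k.
  rewrite !Xval_eq by assumption. rewrite S_INR.
  unfold white_rate. pose proof (urn_total_pos w0 b0 ga n Hw) as HT.
  apply le_INR in Hal. simpl in Hal.
  set (x := INR w0 / INR al + INR k).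
  replace (INR w0 + INR al * INR k) with (INR al * x) by (unfold x; field; lra).
  replace (INR w0 / INR al + (INR k + 1)) with (x + 1) by (unfold x; ring).
  transitivity (rising x s + INR al / urn_total w0 b0 ga n * (x * rising (x + 1) s - x * rising x s)).
  { field; lra. }
  rewrite rising_S. field; lra.
Qed.

(** These are the f_s of the introduction. The division removes a = w0 / al from the recurrence,
    which then involves the rates t_n only. *)
Definition draws_fact (w0 b0 al ga n s : nat) : R :=
  draws_expect w0 b0 al ga n (fun k => falling (INR k) s)
  / rising (INR w0 / INR al) s.

Lemma white_share_pos (w0 al : nat) : (1 <= al)%nat -> (1 <= w0)%nat -> 0 < INR w0 / INR al.
Proof.
  intros Hal Hw. apply le_INR in Hal, Hw. simpl in *. apply Rdiv_lt_0_compat; lra.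
Qed.

Lemma draws_fact_0 (w0 b0 al ga n : nat) : draws_fact w0 b0 al ga n 0 = 1.
Proof. unfold draws_fact. simpl. rewrite draws_expect_const. field. Qed.

Lemma draws_fact_init (w0 b0 al ga s : nat) : draws_fact w0 b0 al ga 0 (S s) = 0.
Proof.
  unfold draws_fact. rewrite draws_expect_0.
  replace (falling (INR 0) (S s)) with 0; [unfold Rdiv; ring|].
  induction s as [|s IH]; [simpl; ring|].
  change (0 = falling (INR 0) (S s) * (INR 0 - INR (S s))). rewrite <- IH. ring.
Qed.

(** The increment of the falling factorial of order s + 1 is s + 1 times the one of order s. Writing
    a + k = (k - s) + (a + s) in the probability of a white draw gives the orders s + 1 and s, and a
    + s is the factor by which the two normalisations differ. *)
Lemma draws_fact_S (w0 b0 al ga n s : nat) :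
  (1 <= al)%nat -> (1 <= w0)%nat ->
  draws_fact w0 b0 al ga (S n) (S s) =
  draws_fact w0 b0 al ga n (S s) + INR (S s) * white_rate w0 b0 al ga n *
    (draws_fact w0 b0 al ga n (S s) + draws_fact w0 b0 al ga n s).
Proof.
  intros Hal Hw. unfold draws_fact.
  pose proof (white_share_pos w0 al Hal Hw) as Ha.
  pose proof (urn_total_pos w0 b0 ga n Hw) as HT.
  set (a := INR w0 / INR al) in *.
  pose proof (rising_pos a s Ha) as Hr.
  pose proof (pos_INR s) as Hs.
  change (rising a (S s)) with (rising a s * (a + INR s)).
  set (t := white_rate w0 b0 al ga n).
  assert (H : draws_expect w0 b0 al ga (S n) (fun k => falling (INR k) (S s)) =
     (1 + INR (S s) * t) * draws_expect w0 b0 al ga n (fun k => falling (INR k) (S s))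
     + INR (S s) * t * (a + INR s) * draws_expect w0 b0 al ga n (fun k => falling (INR k) s)).
  { rewrite draws_expect_S, <- draws_expect_lin. apply draws_expect_ext. intros k.
    replace (falling (INR (S k)) (S s) - falling (INR k) (S s))
      with (INR (S s) * falling (INR k) s) by (rewrite <- falling_diff, (S_INR k); reflexivity).
    apply le_INR in Hal. simpl in Hal.
    replace ((INR w0 + INR al * INR k) / urn_total w0 b0 ga n) with (t * (a + INR k))
      by (unfold t, a, white_rate; field; lra).
    change (falling (INR k) (S s)) with (falling (INR k) s * (INR k - INR s)). ring. }
  rewrite H. field. lra.
Qed.

Lemma draws_expect_falling (w0 b0 al ga n s : nat) :
  (1 <= al)%nat -> (1 <= w0)%nat ->
  urn_expect w0 b0 al ga n (fun x => falling (x - INR w0 / INR al) s) =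
  draws_fact w0 b0 al ga n s * rising (INR w0 / INR al) s.
Proof.
  intros Hal Hw.
  pose proof (rising_pos _ s (white_share_pos w0 al Hal Hw)).
  unfold draws_fact. field_simplify; [|lra].
  apply draws_expect_ext. intros k. rewrite Xval_eq by assumption. f_equal. ring.
Qed.

(** * Factorial moments and the growth product *)

(* This is [1 + g_n]. The argument [w0] need not be that of the urn: [lam] is compared
   with the products for [w0 = 0] and [w0 = be]. *)
Fixpoint urn_growth (w0 b0 al ga n : nat) : R :=
  match n with
  | O => 1
  | S m => urn_growth w0 b0 al ga m * (1 + white_rate w0 b0 al ga m)
  end.

Lemma urn_total_ge (w0 b0 ga n : nat) : INR w0 + INR b0 <= urn_total w0 b0 ga n.
Proof.
  unfold urn_total. pose proof (pos_INR n); pose proof (pos_INR ga); nra.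
Qed.

Lemma white_rate_ge0 (w0 b0 al ga n : nat) : 0 <= white_rate w0 b0 al ga n.
Proof.
  unfold white_rate. pose proof (pos_INR al).
  pose proof (urn_total_ge w0 b0 ga n) as HT.
  pose proof (pos_INR w0); pose proof (pos_INR b0).
  (* An empty urn is allowed here; its rate is 0 by the convention / 0 = 0. *)
  destruct (Req_dec (urn_total w0 b0 ga n) 0) as [E|E].
  - rewrite E. unfold Rdiv. rewrite Rinv_0. lra.
  - apply Rdiv_le_0_compat; lra.
Qed.

Lemma urn_growth_ge1 (w0 b0 al ga n : nat) : 1 <= urn_growth w0 b0 al ga n.
Proof.
  induction n as [|n IH]; simpl; [lra|]. pose proof (white_rate_ge0 w0 b0 al ga n). nra.
Qed.

(** As [al <= ga], each factor 1 + al / T_n is at most T_(n+1) / T_n, and these telescope. The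
    consequence needed later is t_n (1 + g_n) <= t_0. *)
Lemma urn_growth_le_total (w0 b0 al ga n : nat) :
  (al <= ga)%nat -> 0 < INR w0 + INR b0 ->
  urn_growth w0 b0 al ga n * (INR w0 + INR b0) <= urn_total w0 b0 ga n.
Proof.
  intros Hag H0. induction n as [|n IH].
  - unfold urn_total. simpl. lra.
  - simpl urn_growth. rewrite urn_total_S.
    pose proof (urn_total_ge w0 b0 ga n). apply le_INR in Hag.
    pose proof (white_rate_ge0 w0 b0 al ga n) as Ht.
    assert (E : urn_total w0 b0 ga n * white_rate w0 b0 al ga n = INR al)
      by (unfold white_rate; field; lra).
    nra.
Qed.

(** * Dependence of the growth product on w0, and comparison with [lam] *)

Lemma white_rate_antitone (w w' b0 al ga n : nat) :
  (w <= w')%nat -> 0 < INR b0 -> white_rate w' b0 al ga n <= white_rate w b0 al ga n.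
Proof.
  intros Hw Hb. apply le_INR in Hw. unfold white_rate.
  pose proof (urn_total_ge w b0 ga n). pose proof (pos_INR w).
  apply Rmult_le_compat_l; [apply pos_INR|].
  apply Rinv_le_contravar; [lra|]. unfold urn_total. lra.
Qed.

Lemma urn_growth_antitone (w w' b0 al ga n : nat) :
  (w <= w')%nat -> 0 < INR b0 -> urn_growth w' b0 al ga n <= urn_growth w b0 al ga n.
Proof.
  intros Hw Hb. induction n as [|n IH]; simpl; [lra|].
  pose proof (white_rate_antitone w w' b0 al ga n Hw Hb).
  pose proof (white_rate_ge0 w' b0 al ga n). pose proof (urn_growth_ge1 w' b0 al ga n).
  apply Rmult_le_compat; lra.
Qed.

(** The factor is b0 / (b0 - c), uniformly in n. In one step the product without the c balls gains
    an extra t v A with v = c / U. The induction closes if v (1 + (1 + eta) (B - 1)) <= eta, which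
    follows from B b0 <= U. *)
Lemma urn_growth_shift (c b0 al ga n : nat) :
  (al <= ga)%nat -> (c < b0)%nat ->
  urn_growth 0 b0 al ga n - 1 <=
  (1 + INR c / (INR b0 - INR c)) * (urn_growth c b0 al ga n - 1).
Proof.
  intros Hag Hc.
  assert (Hb : 0 < INR b0 - INR c) by (apply lt_INR in Hc; lra).
  pose proof (pos_INR c) as Hc0. pose proof (pos_INR b0) as Hb0.
  set (eta := INR c / (INR b0 - INR c)).
  assert (He : eta * (INR b0 - INR c) = INR c) by (unfold eta; field; lra).
  assert (He0 : 0 <= eta) by (apply Rdiv_le_0_compat; lra).
  induction n as [|n IH]; [simpl; lra|].
  simpl urn_growth.
  set (A := urn_growth 0 b0 al ga n) in *.
  set (B := urn_growth c b0 al ga n) in *.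
  set (t := white_rate c b0 al ga n).
  set (U := urn_total 0 b0 ga n).
  assert (HU : INR b0 <= U) by (pose proof (urn_total_ge 0 b0 ga n) as HH; simpl in HH; unfold U; lra).
  assert (Et : white_rate 0 b0 al ga n = t + t * (INR c / U)).
  { unfold t, white_rate. fold U.
    replace (urn_total c b0 ga n) with (U + INR c) by (unfold U, urn_total; simpl; ring).
    field. lra. }
  rewrite Et.
  pose proof (white_rate_ge0 c b0 al ga n : 0 <= t) as Ht.
  pose proof (urn_growth_ge1 c b0 al ga n : 1 <= B) as HB.
  assert (HBU : B * INR b0 <= U).
  { apply Rle_trans with (urn_growth 0 b0 al ga n * INR b0).
    - apply Rmult_le_compat_r; [lra|]. apply urn_growth_antitone; [lia|lra].
    - pose proof (urn_growth_le_total 0 b0 al ga n Hag) as HH. simpl in HH.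
      rewrite Rplus_0_l in HH. apply HH. lra. }
  set (v := INR c / U) in *.
  assert (Hv0 : 0 <= v) by (apply Rdiv_le_0_compat; lra).
  assert (HvB : v * B * (1 + eta) <= eta).
  { assert (Hv : v * U = INR c) by (unfold v; field; lra).
    apply Rmult_le_reg_r with (INR b0); [lra|].
    (* This is eta b0 = c (1 + eta), the equation that determines eta. *)
    replace (eta * INR b0) with (v * U * (1 + eta)) by (rewrite Hv; nra).
    assert (v * (B * INR b0) <= v * U) by (apply Rmult_le_compat_l; assumption).
    nra. }
  assert (H1 : A * (1 + (t + t * v)) - 1 <=
               (1 + (1 + eta) * (B - 1)) * (1 + (t + t * v)) - 1).
  { assert (0 <= t * v) by (apply Rmult_le_pos; assumption). nra. }
  assert (H2 : t * (v * (1 + (1 + eta) * (B - 1))) <= t * eta).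
  { apply Rmult_le_compat_l; [exact Ht|]. nra. }
  nra.
Qed.

(** Convexity of exp between 0 and L. The tangent at th L lies below exp at L and at 0; with weights
    th and 1 - th the linear terms cancel. *)
Lemma exp_convex_0 (th L : R) : 0 <= th <= 1 -> exp (th * L) <= 1 - th + th * exp L.
Proof.
  intros Hth.
  pose proof (exp_pos (th * L)) as Hp.
  assert (H1 : exp (th * L) * (1 + (1 - th) * L) <= exp L).
  { replace (exp L) with (exp (th * L) * exp ((1 - th) * L))
      by (rewrite <- exp_plus; f_equal; ring).
    apply Rmult_le_compat_l; [lra | apply exp_ineq1_le]. }
  assert (H2 : exp (th * L) * (1 + - (th * L)) <= 1).
  { replace 1 with (exp (th * L) * exp (- (th * L))) at 2
      by (rewrite <- exp_plus, Rplus_opp_r; apply exp_0).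
    apply Rmult_le_compat_l; [lra | apply exp_ineq1_le]. }
  nra.
Qed.

(* Bernoulli's inequality, for the upper bound with the ratio [(U+ga)/U] and for
   the lower bound with its inverse. *)
Lemma Rpower_step_bounds (al be ga : nat) (U : R) :
  (1 <= al)%nat -> ga = (al + be)%nat -> 0 < U ->
  1 + INR al / (U + INR be) <= Rpower ((U + INR ga) / U) (INR al / INR ga)
    <= 1 + INR al / U.
Proof.
  intros Hal -> HU. rewrite plus_INR.
  apply le_INR in Hal. simpl in Hal. pose proof (pos_INR be) as Hbe.
  set (A := INR al) in *. set (B := INR be) in *.
  assert (Hth : 0 <= A / (A + B) <= 1).
  { split; [apply Rdiv_le_0_compat; lra|].
    apply Rmult_le_reg_r with (A + B); [lra|]. field_simplify; lra. }
  assert (Hr : 0 < (U + (A + B)) / U) by (apply Rdiv_lt_0_compat; lra).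
  unfold Rpower. set (L := ln ((U + (A + B)) / U)).
  assert (EL : exp L = (U + (A + B)) / U) by (unfold L; now rewrite exp_ln).
  split.
  - pose proof (exp_convex_0 _ (- L) Hth) as H.
    rewrite Ropp_mult_distr_r_reverse, !exp_Ropp, EL in H.
    pose proof (exp_pos (A / (A + B) * L)) as Hp.
    set (E := exp (A / (A + B) * L)) in *.
    replace (1 - A / (A + B) + A / (A + B) * / ((U + (A + B)) / U))
      with (/ (1 + A / (U + B))) in H by (field; lra).
    apply Rinv_le_contravar in H; [|now apply Rinv_0_lt_compat].
    now rewrite !Rinv_inv in H.
  - pose proof (exp_convex_0 _ L Hth) as H. rewrite EL in H.
    eapply Rle_trans; [exact H|]. right. field. lra.
Qed.

(** The base of the power in [lam] is the telescoping product of (U + ga) / U over the totals U = b0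
    + m ga of an urn without white balls. Raised to the power al / ga, each factor lies between the
    growth factors of the urns with be and with 0 white balls. *)
Lemma lam_bounds (al be ga b0 n : nat) :
  (1 <= al)%nat -> ga = (al + be)%nat -> (1 <= b0)%nat ->
  urn_growth be b0 al ga n - 1 <= lam al ga n b0 <= urn_growth 0 b0 al ga n - 1.
Proof.
  intros Hal Hga Hb. unfold lam.
  assert (Hga0 : 0 < INR ga) by (apply lt_0_INR; lia).
  assert (Hb0 : 0 < INR b0) by (apply lt_0_INR; lia).
  set (x := fun n => (INR n + INR b0 / INR ga) / (INR b0 / INR ga)).
  change ((INR n + INR b0 / INR ga) / (INR b0 / INR ga)) with (x n).
  cut (urn_growth be b0 al ga n <= Rpower (x n) (INR al / INR ga)
         <= urn_growth 0 b0 al ga n); [lra|].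
  induction n as [|n IH].
  - replace (x 0%nat) with 1 by (unfold x; simpl; field; lra).
    unfold Rpower. rewrite ln_1, Rmult_0_r, exp_0. simpl. lra.
  - set (U := urn_total 0 b0 ga n).
    assert (EU : U = INR b0 + INR n * INR ga) by (unfold U, urn_total; simpl; ring).
    pose proof (pos_INR n). assert (HU : 0 < U) by (rewrite EU; nra).
    replace (x (S n)) with (x n * ((U + INR ga) / U))
      by (unfold x; rewrite EU, S_INR; field; rewrite EU in HU; lra).
    assert (Hx : 0 < x n).
    { unfold x. apply Rdiv_lt_0_compat; [|apply Rdiv_lt_0_compat; lra].
      assert (0 < INR b0 / INR ga) by (apply Rdiv_lt_0_compat; lra). lra. }
    unfold Rpower at 1 2. rewrite ln_mult;
      [|exact Hx|apply Rdiv_lt_0_compat; lra].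
    rewrite Rmult_plus_distr_l, exp_plus.
    fold (Rpower (x n) (INR al / INR ga)) (Rpower ((U + INR ga) / U) (INR al / INR ga)).
    destruct (Rpower_step_bounds al be ga U Hal Hga HU) as [H1 H2].
    simpl urn_growth.
    replace (white_rate 0 b0 al ga n) with (INR al / U) by reflexivity.
    replace (white_rate be b0 al ga n) with (INR al / (U + INR be))
      by (unfold white_rate; f_equal; rewrite EU; unfold urn_total; ring).
    pose proof (urn_growth_ge1 be b0 al ga n).
    assert (0 <= INR al / (U + INR be))
      by (apply Rdiv_le_0_compat; [apply pos_INR | pose proof (pos_INR be); lra]).
    split; apply Rmult_le_compat; lra.
Qed.

(** * Factorial moments against powers of g_n *)

Lemma pow_plus_ge (g h : R) (r : nat) :
  0 <= g -> 0 <= h -> g ^ S r + INR (S r) * h * g ^ r <= (g + h) ^ S r.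
Proof.
  intros Hg Hh. induction r as [|r IH]; [simpl; lra|].
  change ((g + h) ^ S (S r)) with ((g + h) * (g + h) ^ S r).
  apply Rle_trans with ((g + h) * (g ^ S r + INR (S r) * h * g ^ r)).
  - rewrite (S_INR (S r)). simpl pow. pose proof (pow_le g r Hg). pose proof (pos_INR (S r)).
    assert (0 <= INR (S r) * h * h * g ^ r) by (repeat apply Rmult_le_pos; assumption). nra.
  - apply Rmult_le_compat_l; lra.
Qed.

(** The condition h <= g lets all higher powers of h be absorbed into h^2 g^r, with a constant that
    depends on r only. *)
Lemma pow_plus_le (r : nat) : exists K, 0 <= K /\ forall g h, 0 <= h <= g ->
  (g + h) ^ S (S r) <= g ^ S (S r) + INR (S (S r)) * h * g ^ S r + K * h ^ 2 * g ^ r.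
Proof.
  induction r as [|r [K [HK IH]]].
  - exists 1. split; [lra|]. intros. simpl. lra.
  (* Multiplying by g + h gives the new terms N h^2 g^(r+1), K h^2 g^(r+1) and K h^3 g^r; the last
     one is at most K h^2 g^(r+1). *)
  - exists (2 * K + INR (S (S r))). pose proof (pos_INR (S (S r))) as HS. split; [lra|].
    intros g h Hh. specialize (IH g h Hh).
    change ((g + h) ^ S (S (S r))) with ((g + h) * (g + h) ^ S (S r)).
    eapply Rle_trans; [apply Rmult_le_compat_l; [lra|exact IH]|].
    rewrite (S_INR (S (S r))). set (N := INR (S (S r))) in *. simpl pow.
    assert (Hg : 0 <= g ^ r) by (apply pow_le; lra).
    assert (0 <= K * h * h * g ^ r * (g - h)) by (repeat apply Rmult_le_pos; lra).
    nra.
Qed.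

Lemma urn_growth_mono (w0 b0 al ga n m : nat) :
  (n <= m)%nat -> urn_growth w0 b0 al ga n <= urn_growth w0 b0 al ga m.
Proof.
  induction 1 as [|m _ IH]; [lra|]. simpl.
  pose proof (urn_growth_ge1 w0 b0 al ga m). pose proof (white_rate_ge0 w0 b0 al ga m). nra.
Qed.

Lemma draws_fact_1 (w0 b0 al ga n : nat) :
  (1 <= al)%nat -> (1 <= w0)%nat ->
  draws_fact w0 b0 al ga n 1 = urn_growth w0 b0 al ga n - 1.
Proof.
  intros Hal Hw. induction n as [|n IH]; [rewrite draws_fact_init; simpl; ring|].
  rewrite draws_fact_S, draws_fact_0, IH by assumption. simpl. ring.
Qed.

(** One step adds h = t_n (1 + g_n) to g_n, so by [pow_plus_ge] the power r + 1 gains at least (r +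
    1) t_n (g_n^(r+1) + g_n^r), which is the increment in [draws_fact_S]. *)
Lemma draws_fact_le (w0 b0 al ga n r : nat) :
  (1 <= al)%nat -> (1 <= w0)%nat ->
  draws_fact w0 b0 al ga n r <= (urn_growth w0 b0 al ga n - 1) ^ r.
Proof.
  intros Hal Hw. revert n. induction r as [|r IHr]; intros n.
  { rewrite draws_fact_0. simpl. lra. }
  induction n as [|n IH]; [rewrite draws_fact_init; simpl; lra|].
  rewrite draws_fact_S by assumption.
  pose proof (urn_growth_ge1 w0 b0 al ga n) as Hg.
  pose proof (white_rate_ge0 w0 b0 al ga n) as Ht.
  specialize (IHr n).
  simpl urn_growth. set (t := white_rate w0 b0 al ga n) in *.
  set (g := urn_growth w0 b0 al ga n - 1) in *.
  replace (urn_growth w0 b0 al ga n * (1 + t) - 1) with (g + t * (1 + g)) by (unfold g; ring).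
  assert (Hh : 0 <= t * (1 + g)) by (apply Rmult_le_pos; unfold g; lra).
  assert (Hg0 : 0 <= g) by (unfold g; lra).
  pose proof (pow_plus_ge g _ r Hg0 Hh) as H.
  eapply Rle_trans; [|exact H].
  pose proof (pos_INR (S r)).
  assert (INR (S r) * t * (draws_fact w0 b0 al ga n (S r) + draws_fact w0 b0 al ga n r)
     <= INR (S r) * t * (g ^ S r + g ^ r)).
  { apply Rmult_le_compat_l; [apply Rmult_le_pos; assumption|]. lra. }
  simpl pow in *. nra.
Qed.

(** Divided by g_n^(r+1), the bound becomes C (t_0 + t_0 / g_n), which is small even if g_n tends to
    0, as long as t_0 is small compared with g_n. The constant is the same for all urns, because b0
    will vary with n. *)
Lemma draws_fact_ge (r : nat) : exists C, 0 <= C /\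
  forall w0 b0 al ga n, (1 <= al)%nat -> (1 <= w0)%nat -> (al <= ga)%nat -> (1 <= n)%nat ->
  (urn_growth w0 b0 al ga n - 1) ^ S r - draws_fact w0 b0 al ga n (S r) <=
  C * white_rate w0 b0 al ga 0 * (urn_growth w0 b0 al ga n - 1) ^ r
    * urn_growth w0 b0 al ga n.
Proof.
  induction r as [|r [C0 [HC0 IHr]]].
  { exists 0. split; [lra|]. intros. rewrite draws_fact_1 by assumption. simpl. lra. }
  destruct (pow_plus_le r) as [K [HK Hpow]].
  pose proof (pos_INR (S (S r))) as HS.
  (* The summands pay for the error of the order below, for the second order remainder and for the
     case n = 1. *)
  exists (INR (S (S r)) * C0 + K + 1).
  split; [nra|].
  intros w0 b0 al ga n Hal Hw Hag Hn.
  set (C := INR (S (S r)) * C0 + K + 1).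
  set (e := white_rate w0 b0 al ga 0).
  assert (He : 0 <= e) by apply white_rate_ge0.
  (* The induction starts at n = 1, where g_1 = t_0: the remainder bound asks for h <= g, and h =
     t_n G_n <= t_0 <= g_n holds from there on. *)
  induction Hn as [|n Hn IH].
  - rewrite draws_fact_S, !draws_fact_init by assumption. simpl urn_growth.
    fold e. replace (1 * (1 + e) - 1) with e by ring.
    assert (0 <= e * e ^ S r) by (apply Rmult_le_pos; [|apply pow_le]; assumption).
    assert (HC : 1 <= C) by (unfold C; nra).
    change (e ^ S (S r)) with (e * e ^ S r).
    set (q := e * e ^ S r) in *. fold e.
    apply Rle_trans with (1 * q * 1); [lra|].
    apply Rle_trans with (C * q * (1 + e)); [|unfold q; lra].
    apply Rmult_le_compat; try lra. apply Rmult_le_compat_r; assumption.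
  - specialize (IHr w0 b0 al ga n Hal Hw Hag Hn).
    rewrite draws_fact_S by assumption. simpl urn_growth. fold e in IHr.
    set (t := white_rate w0 b0 al ga n) in *.
    assert (Ht : 0 <= t) by apply white_rate_ge0.
    set (G := urn_growth w0 b0 al ga n) in *.
    assert (HG : 1 <= G) by apply urn_growth_ge1.
    set (g := G - 1) in *.
    replace (G * (1 + t) - 1) with (g + t * G) by (unfold g; ring).
    assert (Hh : 0 <= t * G) by (apply Rmult_le_pos; lra).
    pose proof (urn_total_pos w0 b0 ga n Hw) as HT.
    assert (HT0 : 0 < INR w0 + INR b0).
    { apply le_INR in Hw. simpl in Hw. pose proof (pos_INR b0). lra. }
    assert (Hhe : t * G <= e).
    { pose proof (urn_growth_le_total w0 b0 al ga n Hag HT0) as HH. fold G in HH.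
      unfold t, e, white_rate.
      replace (urn_total w0 b0 ga 0) with (INR w0 + INR b0) by (unfold urn_total; simpl; ring).
      apply Rmult_le_reg_r with (urn_total w0 b0 ga n * (INR w0 + INR b0)); [nra|].
      field_simplify; try lra.
      pose proof (pos_INR al). nra. }
    assert (Heg : e <= g).
    { pose proof (urn_growth_mono w0 b0 al ga 1 n Hn) as HH. simpl in HH. fold e G in HH.
      unfold g. lra. }
    assert (Hg0 : 0 <= g) by lra.
    specialize (Hpow g (t * G) ltac:(lra)).
    pose proof (pow_plus_ge g (t * G) r Hg0 Hh) as Hlow.
    set (s := INR (S (S r))) in *.
    set (f2 := draws_fact w0 b0 al ga n (S (S r))) in *.
    set (f1 := draws_fact w0 b0 al ga n (S r)) in *.
    assert (Es : s = INR (S r) + 1) by (unfold s; apply S_INR).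
    set (p := g ^ r) in *.
    assert (Hp : 0 <= p) by (apply pow_le; assumption).
    change (g ^ S (S r)) with (g * (g * p)) in *.
    change (g ^ S r) with (g * p) in *.
    assert (Hr0 : 0 <= INR (S r)) by apply pos_INR.
    assert (Hr1 : 1 <= INR (S r)) by (rewrite S_INR; pose proof (pos_INR r); lra).
    assert (HC : s * C0 + K <= C * INR (S r)).
    { assert (0 <= C) by (unfold C; nra). unfold C in *. nra. }
    assert (HC1 : 0 <= C) by (unfold C; nra).
    assert (E1 : K * (t * G) ^ 2 * p <= K * e * (t * G) * p).
    { replace (K * (t * G) ^ 2 * p) with (K * p * (t * G) * (t * G)) by ring.
      replace (K * e * (t * G) * p) with (K * p * (t * G) * e) by ring.
      apply Rmult_le_compat_l; [|exact Hhe].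
      apply Rmult_le_pos; [apply Rmult_le_pos|]; assumption. }
    assert (EG : s * (t * G) * (g * p) = s * t * (g * (g * p) + g * p))
      by (unfold g; ring).
    (* The new error has three sources: the old error enlarged by 1 + s t, the error of the order
       below, and the second order part of the power. *)
    apply Rle_trans with ((1 + s * t) * (g * (g * p) - f2) + s * t * (g * p - f1)
                          + K * e * (t * G) * p).
    { lra. }
    apply Rle_trans with ((1 + s * t) * (C * e * (g * p) * G) + s * t * (C0 * e * p * G)
                          + K * e * (t * G) * p).
    { apply Rplus_le_compat_r. apply Rplus_le_compat; apply Rmult_le_compat_l; try assumption.
      - assert (0 <= s * t) by (apply Rmult_le_pos; assumption). lra.
      - apply Rmult_le_pos; assumption. }
    (* The target, with (g + t G)^(r+1) replaced by its first order part. Since s = (r + 1) + 1, the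
       terms with C g^(r+1) then agree on both sides up to first order in t, and C (r + 1) t g^r
       remains to absorb (s C0 + K) t g^r. *)
    apply Rle_trans with (C * e * (g * p + INR (S r) * (t * G) * p) * (G * (1 + t))).
    2:{ apply Rmult_le_compat_r; [nra|]. apply Rmult_le_compat_l; [|exact Hlow].
        apply Rmult_le_pos; assumption. }
    assert (HeG : 0 <= e * G) by (apply Rmult_le_pos; lra).
    cut ((1 + s * t) * (C * (g * p)) + s * t * (C0 * p) + K * t * p <=
         C * (g * p + INR (S r) * (t * G) * p) * (1 + t)).
    { intros HH. apply Rmult_le_compat_l with (r := e * G) in HH; [|exact HeG]. nra. }
    assert (Htp : 0 <= t * p) by (apply Rmult_le_pos; assumption).
    assert (X1 : (s * C0 + K) * (t * p) <= C * INR (S r) * (t * p))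
      by (apply Rmult_le_compat_r; assumption).
    assert (X2 : 0 <= C * INR (S r) * (t * p) * t * (1 + g)).
    { apply Rmult_le_pos; [|lra]. apply Rmult_le_pos; [|exact Ht].
      apply Rmult_le_pos; [|exact Htp]. apply Rmult_le_pos; assumption. }
    replace G with (1 + g) by (unfold g; ring). rewrite Es in *. nra.
Qed.

(** * Limits of the ratios between f_s, powers of g_n and powers of [lam] *)

Lemma is_lim_seq_INR_large (b : nat -> nat) (c : nat) :
  is_lim_seq (fun n => INR (b n)) p_infty -> eventually (fun n => (c < b n)%nat).
Proof.
  intros H. apply is_lim_seq_spec in H. destruct (H (INR c)) as [N HN].
  exists N. intros n Hn. apply INR_lt. now apply HN.
Qed.

Lemma is_lim_seq_scal_inv (b : nat -> nat) (c : R) :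
  is_lim_seq (fun n => INR (b n)) p_infty -> is_lim_seq (fun n => c / INR (b n)) 0.
Proof.
  intros H. replace (Finite 0) with (Rbar_mult c 0) by (simpl; f_equal; ring).
  apply is_lim_seq_scal_l. replace (Finite 0) with (Rbar_inv p_infty) by reflexivity.
  apply is_lim_seq_inv; [exact H | discriminate].
Qed.

(** The rates decrease, so each of the n factors contributes at least the last rate. It yields t_0 /
    g_n <= t_0 / (n t_n) = T_n / (n T_0). *)
Lemma urn_growth_ge_linear (w0 b0 al ga n : nat) :
  0 < INR w0 + INR b0 -> 1 + INR n * white_rate w0 b0 al ga n <= urn_growth w0 b0 al ga n.
Proof.
  intros H0. induction n as [|n IH]; [simpl; lra|].
  simpl urn_growth. rewrite S_INR.
  assert (Hd : white_rate w0 b0 al ga (S n) <= white_rate w0 b0 al ga n).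
  { unfold white_rate. apply Rmult_le_compat_l; [apply pos_INR|].
    pose proof (urn_total_ge w0 b0 ga n). rewrite urn_total_S.
    pose proof (pos_INR ga). apply Rinv_le_contravar; lra. }
  pose proof (white_rate_ge0 w0 b0 al ga n) as Ht. pose proof (pos_INR n) as Hn.
  assert ((INR n + 1) * white_rate w0 b0 al ga (S n) <= (INR n + 1) * white_rate w0 b0 al ga n)
    by (apply Rmult_le_compat_l; lra).
  assert (0 <= INR n * white_rate w0 b0 al ga n) by (apply Rmult_le_pos; assumption).
  nra.
Qed.

Lemma urn_growth_gt1 (w0 b0 al ga n : nat) :
  (1 <= al)%nat -> (1 <= n)%nat -> 0 < INR w0 + INR b0 -> 1 < urn_growth w0 b0 al ga n.
Proof.
  intros Hal Hn H0. eapply Rlt_le_trans; [|now apply urn_growth_ge_linear].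
  assert (0 < white_rate w0 b0 al ga n).
  { unfold white_rate. pose proof (urn_total_ge w0 b0 ga n).
    apply Rdiv_lt_0_compat; [apply lt_0_INR; lia | lra]. }
  assert (0 < INR n) by (apply lt_0_INR; lia). nra.
Qed.

Lemma lam_pos (al be ga b0 n : nat) :
  (1 <= al)%nat -> ga = (al + be)%nat -> (1 <= b0)%nat -> (1 <= n)%nat ->
  0 < lam al ga n b0.
Proof.
  intros Hal Hga Hb Hn.
  destruct (lam_bounds al be ga b0 n Hal Hga Hb) as [H _].
  assert (0 < INR b0) by (apply lt_0_INR; lia). pose proof (pos_INR be).
  pose proof (urn_growth_gt1 be b0 al ga n Hal Hn ltac:(lra)). lra.
Qed.

(** With c = w0 + be, monotonicity in the number of white balls places both g_n and [lam] between
    the products for c and for 0 white balls, minus 1. By [urn_growth_shift] these differ by a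
    factor at most 1 / (1 - c / b0). *)
Lemma growth_lam_ratio (al be ga w0 : nat) (b : nat -> nat) :
  (1 <= al)%nat -> ga = (al + be)%nat -> is_lim_seq (fun n => INR (b n)) p_infty ->
  is_lim_seq (fun n => (urn_growth w0 (b n) al ga n - 1) / lam al ga n (b n)) 1.
Proof.
  intros Hal Hga Hb. set (c := (w0 + be)%nat).
  apply is_lim_seq_le_le_loc with
    (u := fun n => 1 - INR c / INR (b n)) (w := fun n => / (1 - INR c / INR (b n))).
  - destruct (is_lim_seq_INR_large b c Hb) as [N HN].
    exists (Nat.max 1 N). intros n Hn. specialize (HN n ltac:(lia)).
    pose proof (urn_growth_shift c (b n) al ga n ltac:(lia) HN) as H.
    assert (Hb0 : 0 < INR (b n)) by (apply lt_0_INR; lia).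
    assert (Hbc : INR c < INR (b n)) by (now apply lt_INR).
    pose proof (lam_pos al be ga (b n) n Hal Hga ltac:(lia) ltac:(lia)) as Hl.
    destruct (lam_bounds al be ga (b n) n Hal Hga ltac:(lia)) as [H1 H2].
    pose proof (urn_growth_antitone be c (b n) al ga n ltac:(lia) Hb0) as H3.
    pose proof (urn_growth_antitone w0 c (b n) al ga n ltac:(lia) Hb0) as H4.
    pose proof (urn_growth_antitone 0 w0 (b n) al ga n ltac:(lia) Hb0) as H5.
    pose proof (pos_INR c).
    replace (1 + INR c / (INR (b n) - INR c)) with (/ (1 - INR c / INR (b n))) in H
      by (field; lra).
    set (q := 1 - INR c / INR (b n)) in *.
    assert (Hq : 0 < q).
    { unfold q. replace (1 - INR c / INR (b n)) with ((INR (b n) - INR c) / INR (b n))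
        by (field; lra). apply Rdiv_lt_0_compat; lra. }
    apply Rmult_le_compat_l with (r := q) in H; [|lra].
    rewrite <- Rmult_assoc, Rinv_r, Rmult_1_l in H by lra.
    split.
    + apply Rmult_le_reg_r with (1 := Hl). unfold Rdiv.
      rewrite Rmult_assoc, Rinv_l by lra. nra.
    + apply Rmult_le_reg_r with (1 := Hl). unfold Rdiv.
      rewrite Rmult_assoc, Rinv_l, Rmult_1_r by lra.
      apply Rmult_le_reg_l with (1 := Hq). rewrite <- Rmult_assoc, Rinv_r by lra. nra.
  - replace (Finite 1) with (Finite (1 - 0)) by (f_equal; ring).
    apply is_lim_seq_minus'; [apply is_lim_seq_const | now apply is_lim_seq_scal_inv].
  - replace (Finite 1) with (Rbar_inv (Finite (1 - 0))) by (simpl; f_equal; field).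
    apply is_lim_seq_inv; [|simpl; intros E; injection E; lra].
    apply is_lim_seq_minus'; [apply is_lim_seq_const | now apply is_lim_seq_scal_inv].
Qed.

Lemma fact_growth_ratio (al be ga w0 r : nat) (b : nat -> nat) :
  (1 <= al)%nat -> (1 <= w0)%nat -> ga = (al + be)%nat ->
  is_lim_seq (fun n => INR (b n)) p_infty ->
  is_lim_seq (fun n => draws_fact w0 (b n) al ga n (S r)
                       / (urn_growth w0 (b n) al ga n - 1) ^ S r) 1.
Proof.
  intros Hal Hw Hga Hb. destruct (draws_fact_ge r) as [C [HC HCr]].
  apply is_lim_seq_le_le_loc with
    (u := fun n => 1 - C * (INR al / INR (b n) + (1 / INR n + INR ga / INR (b n))))
    (w := fun _ => 1).
  - destruct (is_lim_seq_INR_large b 0 Hb) as [N HN].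
    exists (Nat.max 1 N). intros n Hn. specialize (HN n ltac:(lia)).
    specialize (HCr w0 (b n) al ga n Hal Hw ltac:(lia) ltac:(lia)).
    pose proof (draws_fact_le w0 (b n) al ga n (S r) Hal Hw) as Hle.
    assert (Hb0 : 0 < INR (b n)) by (apply lt_0_INR; lia).
    assert (Hn0 : 0 < INR n) by (apply lt_0_INR; lia).
    assert (Hw0 : 0 < INR w0) by (apply lt_0_INR; lia).
    assert (Ha0 : 0 < INR al) by (apply lt_0_INR; lia).
    pose proof (urn_growth_gt1 w0 (b n) al ga n Hal ltac:(lia) ltac:(lra)) as HG.
    pose proof (urn_growth_ge_linear w0 (b n) al ga n ltac:(lra)) as HL.
    set (f := draws_fact w0 (b n) al ga n (S r)) in *.
    set (G := urn_growth w0 (b n) al ga n) in *.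
    set (g := G - 1) in *. assert (Hg : 0 < g) by (unfold g; lra).
    assert (Hp : 0 < g ^ r) by (now apply pow_lt).
    assert (HpS : 0 < g ^ S r) by (now apply pow_lt).
    set (e := white_rate w0 (b n) al ga 0) in *.
    assert (He : e <= INR al / INR (b n)).
    { unfold e, white_rate, urn_total. apply Rmult_le_compat_l; [lra|].
      apply Rinv_le_contravar; simpl; lra. }
    assert (Heg : e / g <= 1 / INR n + INR ga / INR (b n)).
    { apply Rle_trans with (e / (INR n * white_rate w0 (b n) al ga n)).
      - assert (HT : 0 < urn_total w0 (b n) ga n) by (now apply urn_total_pos).
        assert (0 < white_rate w0 (b n) al ga n)
          by (unfold white_rate; apply Rdiv_lt_0_compat; assumption).
        apply Rmult_le_compat_l; [apply white_rate_ge0|].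
        apply Rinv_le_contravar; [nra | unfold g; lra].
      - apply Rle_trans with (1 / INR n + INR ga / (INR w0 + INR (b n))).
        + right. unfold e, white_rate, urn_total. simpl (INR 0). pose proof (pos_INR ga).
          field. repeat split; try lra. nra.
        + apply Rplus_le_compat_l, Rmult_le_compat_l; [apply pos_INR|].
          apply Rinv_le_contravar; lra. }
    split.
    + apply Rle_trans with (1 - C * (e + e / g)).
      * assert (C * (e + e / g) <= C * (INR al / INR (b n) + (1 / INR n + INR ga / INR (b n))))
          by (apply Rmult_le_compat_l; lra). lra.
      * apply Rmult_le_reg_r with (1 := HpS). unfold Rdiv at 2.
        rewrite Rmult_assoc, Rinv_l, Rmult_1_r by lra.
        replace ((1 - C * (e + e / g)) * g ^ S r) with (g ^ S r - C * e * g ^ r * G)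
          by (unfold Rdiv; simpl; replace G with (g + 1) by (unfold g; ring); field; lra).
        lra.
    + apply Rmult_le_reg_r with (1 := HpS). unfold Rdiv.
      rewrite Rmult_assoc, Rinv_l, Rmult_1_r by lra. lra.
  - replace (Finite 1) with (Finite (1 - C * (0 + (0 + 0)))) by (f_equal; ring).
    apply is_lim_seq_minus'; [apply is_lim_seq_const|].
    apply (is_lim_seq_scal_l _ C (0 + (0 + 0))).
    apply is_lim_seq_plus'; [now apply is_lim_seq_scal_inv|].
    apply is_lim_seq_plus'; [|now apply is_lim_seq_scal_inv].
    apply (is_lim_seq_scal_inv (fun n => n)), is_lim_seq_INR.
  - apply is_lim_seq_const.
Qed.

Lemma is_lim_seq_pow (u : nat -> R) (l : R) (s : nat) :
  is_lim_seq u l -> is_lim_seq (fun n => u n ^ s) (l ^ s).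
Proof.
  intros H. induction s as [|s IH]; simpl; [apply is_lim_seq_const|].
  now apply is_lim_seq_mult'.
Qed.

Lemma fact_lam_ratio (al be ga w0 s : nat) (b : nat -> nat) :
  (1 <= al)%nat -> (1 <= w0)%nat -> ga = (al + be)%nat ->
  is_lim_seq (fun n => INR (b n)) p_infty ->
  is_lim_seq (fun n => draws_fact w0 (b n) al ga n s / lam al ga n (b n) ^ s) 1.
Proof.
  intros Hal Hw Hga Hb. destruct s as [|r].
  { apply is_lim_seq_ext with (fun _ => 1); [|apply is_lim_seq_const].
    intros n. rewrite draws_fact_0. simpl. field. }
  pose proof (fact_growth_ratio al be ga w0 r b Hal Hw Hga Hb) as H1.
  pose proof (is_lim_seq_pow _ 1 (S r) (growth_lam_ratio al be ga w0 b Hal Hga Hb)) as H2.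
  rewrite pow1 in H2.
  pose proof (is_lim_seq_mult' _ _ _ _ H1 H2) as H. rewrite Rmult_1_r in H.
  eapply is_lim_seq_ext_loc; [|exact H].
  destruct (is_lim_seq_INR_large b 0 Hb) as [N HN].
  exists (Nat.max 1 N). intros n Hn. specialize (HN n ltac:(lia)).
  pose proof (lam_pos al be ga (b n) n Hal Hga ltac:(lia) ltac:(lia)) as Hl.
  assert (0 < INR (b n)) by (apply lt_0_INR; lia). pose proof (pos_INR w0).
  pose proof (urn_growth_gt1 w0 (b n) al ga n Hal ltac:(lia) ltac:(lra)) as HG.
  unfold Rdiv. rewrite Rpow_mult_distr, pow_inv.
  field. split; apply pow_nonzero; lra.
Qed.

(** * Gamma integrals *)

Lemma ex_RInt_pos_cont (f : R -> R) (x y : R) :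
  (forall z, 0 < z -> continuous f z) -> 0 < x -> x <= y -> ex_RInt f x y.
Proof.
  intros Hf Hx Hxy. apply (@ex_RInt_continuous R_CompleteNormedModule).
  intros z Hz. apply Hf. rewrite Rmin_left in Hz by lra. lra.
Qed.

Lemma at_right_0_lt (x : R) : 0 < x -> at_right 0 (fun y => 0 < y < x).
Proof.
  intros Hx. exists (mkposreal x Hx). intros y Hy Hy0. split; [exact Hy0|].
  unfold ball in Hy; simpl in Hy; unfold AbsRing_ball, abs, minus, plus, opp in Hy; simpl in Hy.
  rewrite Rabs_pos_eq in Hy; lra.
Qed.

Lemma filter_prod_right0 (Fb : (R -> Prop) -> Prop) (FFb : Filter Fb) (D : R -> Prop) (y0 : R) :
  0 < y0 -> Fb (fun y => D y /\ y0 <= y) ->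
  filter_prod (at_right 0) Fb (fun ab => 0 < fst ab <= snd ab).
Proof.
  intros Hy HF.
  apply Filter_prod with (fun x => 0 < x < y0) (fun y => D y /\ y0 <= y).
  - now apply at_right_0_lt.
  - exact HF.
  - intros x y Hx [_ Hy']. simpl. lra.
Qed.

(* The set [D] stands for the possible upper bounds: [(0,oo)] for [p_infty] and
   [{c}] for [at_point c]. *)
Definition cofinal_in (Fb : (R -> Prop) -> Prop) (D : R -> Prop) : Prop :=
  (forall y, D y -> 0 < y) /\ (exists y, D y) /\
  (forall y0, D y0 -> Fb (fun y => D y /\ y0 <= y)).

Lemma cofinal_in_p_infty : cofinal_in (Rbar_locally p_infty) (fun y => 0 < y).
Proof.
  repeat split.
  - trivial.
  - exists 1. lra.
  - intros y0 H0. exists y0. intros y Hy. lra.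
Qed.

Lemma cofinal_in_point (c : R) : 0 < c -> cofinal_in (at_point c) (fun y => y = c).
Proof.
  intros Hc. repeat split.
  - intros y ->. exact Hc.
  - now exists c.
  - unfold at_point; intuition lra.
Qed.

(** The approximating interval can be taken around any prescribed one, which turns statements on
    improper integrals of non-negative functions into monotonicity of proper ones. *)
Lemma is_RInt_gen_approx (f : R -> R) (Fb : (R -> Prop) -> Prop) (D : R -> Prop)
  (FFb : ProperFilter Fb) (l x0 y0 eps : R) :
  cofinal_in Fb D -> is_RInt_gen f (at_right 0) Fb l ->
  0 < x0 -> D y0 -> 0 < eps ->
  exists x y, 0 < x < x0 /\ x <= y /\ D y /\ y0 <= y /\ ex_RInt f x y /\
    Rabs (RInt f x y - l) < eps.
Proof.
  intros [HD [_ HF]] Hl Hx0 Hy0 Heps.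
  specialize (Hl (ball l (mkposreal eps Heps)) (locally_ball l _)).
  destruct Hl as [Q S HQ HS H].
  destruct (filter_ex (F := at_right 0) _ (filter_and _ _ HQ (at_right_0_lt (Rmin x0 y0)
     ltac:(apply Rmin_glb_lt; auto)))) as [x [Hx1 Hx2]].
  destruct (filter_ex (F := Fb) _ (filter_and _ _ HS (HF y0 Hy0))) as [y [Hy1 [Hy2 Hy3]]].
  pose proof (Rmin_l x0 y0). pose proof (Rmin_r x0 y0).
  exists x, y. destruct (H x y Hx1 Hy1) as [v [Hv Hb]]. simpl in Hv.
  repeat split; try lra; try assumption.
  - now exists v.
  - rewrite (is_RInt_unique _ _ _ _ Hv). exact Hb.
Qed.

Lemma is_RInt_gen_upper (f : R -> R) (Fb : (R -> Prop) -> Prop) (D : R -> Prop)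
  (FFb : ProperFilter Fb) (l M : R) :
  cofinal_in Fb D -> is_RInt_gen f (at_right 0) Fb l ->
  (forall x y, 0 < x -> x <= y -> D y -> RInt f x y <= M) -> l <= M.
Proof.
  intros HC Hl HM. apply le_epsilon. intros eps Heps.
  destruct (proj1 (proj2 HC)) as [y0 Hy0].
  destruct (is_RInt_gen_approx f Fb D FFb l 1 y0 eps HC Hl Rlt_0_1 Hy0 Heps)
    as [x [y (Hx & Hxy & Dy & _ & _ & Ha)]].
  apply Rabs_def2 in Ha. specialize (HM x y ltac:(lra) Hxy Dy). lra.
Qed.

Lemma RInt_subinterval (f : R -> R) (x x' y y' : R) :
  (forall z, 0 < z -> continuous f z) -> (forall z, 0 < z -> 0 <= f z) ->
  0 < x' -> x' <= x -> x <= y -> y <= y' -> RInt f x y <= RInt f x' y'.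
Proof.
  intros Hc Hf H1 H2 H3 H4.
  assert (E : forall u v, 0 < u -> u <= v -> ex_RInt f u v)
    by (intros; now apply ex_RInt_pos_cont).
  rewrite <- (RInt_Chasles f x' x y') by (apply E; lra).
  rewrite <- (RInt_Chasles f x y y') by (apply E; lra).
  unfold plus; simpl.
  assert (0 <= RInt f x' x) by (apply RInt_ge_0; [lra | apply E; lra | intros; apply Hf; lra]).
  assert (0 <= RInt f y y') by (apply RInt_ge_0; [lra | apply E; lra | intros; apply Hf; lra]).
  lra.
Qed.

Lemma RInt_le_gen (f : R -> R) (Fb : (R -> Prop) -> Prop) (D : R -> Prop)
  (FFb : ProperFilter Fb) (l x y : R) :
  (forall z, 0 < z -> continuous f z) -> (forall z, 0 < z -> 0 <= f z) ->
  cofinal_in Fb D -> is_RInt_gen f (at_right 0) Fb l ->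
  0 < x -> x <= y -> D y -> RInt f x y <= l.
Proof.
  intros Hc Hf HC Hl Hx Hxy Dy. apply le_epsilon. intros eps Heps.
  destruct (is_RInt_gen_approx f Fb D FFb l x y eps HC Hl Hx Dy Heps)
    as [x' [y' (Hx' & Hxy' & _ & Hy' & _ & Ha)]].
  apply Rabs_def2 in Ha.
  pose proof (RInt_subinterval f x x' y y' Hc Hf ltac:(lra) ltac:(lra) Hxy Hy'). lra.
Qed.

(** The integral is the supremum of the proper integrals, which grow with the interval. *)
Lemma ex_RInt_gen_bounded (f : R -> R) (Fb : (R -> Prop) -> Prop) (D : R -> Prop)
  (FFb : Filter Fb) (M : R) :
  (forall z, 0 < z -> continuous f z) -> (forall z, 0 < z -> 0 <= f z) ->
  cofinal_in Fb D ->
  (forall x y, 0 < x -> x <= y -> D y -> RInt f x y <= M) ->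
  exists l, is_RInt_gen f (at_right 0) Fb l.
Proof.
  intros Hc Hf (HD & [yD HyD] & HF) HM.
  set (E := fun v => exists x y, 0 < x /\ x <= y /\ D y /\ v = RInt f x y).
  destruct (completeness E) as [l [Hub Hlub]].
  - exists M. intros v (x & y & H1 & H2 & H3 & ->). now apply HM.
  - exists (RInt f yD yD), yD, yD. repeat split; auto. lra.
  - exists l. intros P [eps HP].
    assert (HE : exists v, E v /\ l - eps < v).
    { apply Classical_Prop.NNPP. intros Hn. apply (Rlt_irrefl l).
      apply Rle_lt_trans with (l - eps); [|pose proof (cond_pos eps); lra].
      apply Hlub. intros v Hv. apply Rnot_lt_le. intros Hlt. apply Hn. now exists v. }
    destruct HE as (v & (x & y & Hx & Hxy & Dy & ->) & Hv).
    apply Filter_prod with (fun x' => 0 < x' < x) (fun y' => D y' /\ y <= y').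
    + now apply at_right_0_lt.
    + now apply HF.
    + intros x' y' Hx' [Dy' Hy']. simpl. exists (RInt f x' y'). split.
      * apply (@RInt_correct R_CompleteNormedModule). apply ex_RInt_pos_cont; auto; lra.
      * apply HP.
        pose proof (RInt_subinterval f x x' y y' Hc Hf ltac:(lra) ltac:(lra) Hxy Hy').
        assert (RInt f x' y' <= l).
        { apply Hub. exists x', y'. repeat split; auto; lra. }
        change (Rabs (RInt f x' y' - l) < eps). apply Rabs_def1; lra.
Qed.

Lemma is_RInt_gen_ext_pos (f g : R -> R) (Fb : (R -> Prop) -> Prop) (D : R -> Prop)
  (FFb : Filter Fb) (l : R) :
  cofinal_in Fb D -> (forall x, 0 < x -> f x = g x) ->
  is_RInt_gen f (at_right 0) Fb l -> is_RInt_gen g (at_right 0) Fb l.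
Proof.
  intros (HD & [y0 Hy0] & HF) Hfg. apply is_RInt_gen_ext; try typeclasses eauto.
  eapply filter_imp; [|exact (filter_prod_right0 Fb FFb D y0 (HD _ Hy0) (HF _ Hy0))].
  intros [x y] Hxy z. simpl in *. rewrite Rmin_left, Rmax_right by lra.
  intros Hz. apply Hfg. lra.
Qed.

Lemma is_RInt_gen_comp_scal (f : R -> R) (c l : R) :
  0 < c -> is_RInt_gen f (at_right 0) (Rbar_locally p_infty) l ->
  is_RInt_gen (fun y => c * f (c * y)) (at_right 0) (Rbar_locally p_infty) l.
Proof.
  intros Hc Hl P HP. specialize (Hl P HP). destruct Hl as [Q S HQ [M HM] H].
  apply Filter_prod with (fun x => Q (c * x)) (fun y => S (c * y)).
  - destruct HQ as [d Hd].
    assert (Hdc : 0 < d / c) by (apply Rdiv_lt_0_compat; [apply cond_pos | exact Hc]).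
    exists (mkposreal _ Hdc). intros x Hx Hx0. apply Hd; [|apply Rmult_lt_0_compat; lra].
    change (Rabs (x - 0) < d / c) in Hx. change (Rabs (c * x - 0) < d).
    replace (c * x - 0) with (c * (x - 0)) by ring.
    rewrite Rabs_mult, (Rabs_pos_eq c) by lra.
    apply Rmult_lt_compat_l with (r := c) in Hx; [|exact Hc].
    replace (c * (d / c)) with (d : R) in Hx by (field; lra). exact Hx.
  - exists (M / c). intros y Hy. apply HM.
    apply Rmult_lt_compat_l with (r := c) in Hy; [|exact Hc].
    replace (c * (M / c)) with M in Hy by (field; lra). exact Hy.
  - intros x y Hx Hy. destruct (H _ _ Hx Hy) as [v [Hv HPv]]. exists v. split; [|exact HPv].
    simpl in *. pose proof (is_RInt_comp_lin f c 0 x y v) as HH.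
    rewrite !Rplus_0_r in HH. specialize (HH Hv).
    eapply is_RInt_ext; [|exact HH]. intros z _. unfold scal; simpl; unfold mult; simpl.
    now rewrite Rplus_0_r.
Qed.

(** * The Gamma function and the Laplace transform of the Gamma law *)

Definition gamma_integrand (a t : R) : R := Rpower t (a - 1) * exp (- t).

Lemma continuous_gamma_integrand (a z : R) : 0 < z -> continuous (gamma_integrand a) z.
Proof.
  intros Hz. apply (ex_derive_continuous (gamma_integrand a)).
  unfold gamma_integrand, Rpower. auto_derive. exact Hz.
Qed.

Lemma gamma_integrand_pos (a t : R) : 0 < gamma_integrand a t.
Proof. apply Rmult_lt_0_compat; apply exp_pos. Qed.

(** From ln u <= u - 1 at u = t / (2 b), a point chosen so that b u = t / 2 is half of the exponent;
    the constant is (2 b)^b. *)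
Lemma Rpower_exp_bound (b : R) : 0 < b ->
  exists C, 0 < C /\ forall t, 0 < t -> Rpower t b * exp (- t) <= C * exp (- t / 2).
Proof.
  intros Hb. exists (exp (b * ln (2 * b))). split; [apply exp_pos|].
  intros t Ht. unfold Rpower. rewrite <- !exp_plus.
  assert (H : ln (t / (2 * b)) <= t / (2 * b) - 1).
  { rewrite <- (ln_exp (t / (2 * b) - 1)). apply ln_le.
    - apply Rdiv_lt_0_compat; lra.
    - pose proof (exp_ineq1_le (t / (2 * b) - 1)). lra. }
  rewrite ln_div in H by lra.
  apply Rmult_le_compat_l with (r := b) in H; [|lra].
  replace (b * (t / (2 * b) - 1)) with (t / 2 - b) in H by (field; lra).
  destruct (Rle_lt_or_eq_dec (b * ln t + - t) (b * ln (2 * b) + - t / 2)) as [Hlt|Heq].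
  - lra.
  - left. now apply exp_increasing.
  - rewrite Heq. lra.
Qed.

Lemma is_derive_Rpower_exp (a t : R) : 0 < t ->
  is_derive (fun t => Rpower t a * exp (- t)) t
    (a * gamma_integrand a t - gamma_integrand (a + 1) t).
Proof.
  intros Ht. unfold gamma_integrand, Rpower. auto_derive; [exact Ht|].
  replace ((a + 1 - 1) * ln t) with (a * ln t) by ring.
  replace ((a - 1) * ln t) with (a * ln t + - ln t) by ring.
  rewrite exp_plus, (exp_Ropp (ln t)), exp_ln by exact Ht. field. lra.
Qed.

Lemma ex_gamma_integral (a : R) : 0 < a ->
  exists l, is_RInt_gen (gamma_integrand a) (at_right 0) (Rbar_locally p_infty) l.
Proof.
  intros Ha. destruct (Rpower_exp_bound a Ha) as [C [HC HCt]].
  apply ex_RInt_gen_bounded with (D := fun y => 0 < y) (M := 3 * C / a).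
  - apply Rbar_locally_filter.
  - intros; now apply continuous_gamma_integrand.
  - intros; left; apply gamma_integrand_pos.
  - apply cofinal_in_p_infty.
  - intros x y Hx Hxy _.
    (* Integration by parts avoids the singularity of t^(a-1) at 0: the integrand is 1/a times the
       derivative of t^a exp (- t) plus t^a exp (- t), and the latter is at most C exp (- t/2). The
       function [H] is a primitive of this majorant [h]; its boundary terms give 3 C / a. *)
    set (h := fun t => / a * (a * gamma_integrand a t - gamma_integrand (a + 1) t)
                       + C / a * exp (- t / 2)).
    set (H := fun t => / a * (Rpower t a * exp (- t)) + - (2 * C / a) * exp (- t / 2)).
    assert (Hh : is_RInt h x y (minus (H y) (H x))).
    { apply (@is_RInt_derive R_CompleteNormedModule); intros t Ht; rewrite Rmin_left in Ht by lra.
      - apply (is_derive_plus (fun t => / a * (Rpower t a * exp (- t)))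
                 (fun t => - (2 * C / a) * exp (- t / 2))).
        + apply (is_derive_scal (fun t => Rpower t a * exp (- t))). apply is_derive_Rpower_exp. lra.
        + auto_derive; [trivial|]. unfold Rdiv. field. lra.
      - apply (ex_derive_continuous h). unfold h, gamma_integrand, Rpower.
        auto_derive. lra. }
    assert (Hle : RInt (gamma_integrand a) x y <= minus (H y) (H x)).
    { apply (is_RInt_le (gamma_integrand a) h x y); [exact Hxy | | exact Hh|].
      - apply (@RInt_correct R_CompleteNormedModule), ex_RInt_pos_cont; auto.
        intros; now apply continuous_gamma_integrand.
      - intros t Ht. unfold h.
        replace (gamma_integrand (a + 1) t) with (Rpower t a * exp (- t))
          by (unfold gamma_integrand; do 2 f_equal; ring).
        specialize (HCt t ltac:(lra)).
        assert (0 <= / a * (C * exp (- t / 2) - Rpower t a * exp (- t))).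
        { apply Rmult_le_pos; [left; now apply Rinv_0_lt_compat | lra]. }
        replace (/ a * (a * gamma_integrand a t - Rpower t a * exp (- t)) + C / a * exp (- t / 2))
          with (gamma_integrand a t + / a * (C * exp (- t / 2) - Rpower t a * exp (- t)))
          by (field; lra). lra. }
    eapply Rle_trans; [exact Hle|]. unfold minus, plus, opp, H; simpl.
    pose proof (HCt y ltac:(lra)) as HCy.
    assert (Hey : exp (- y / 2) <= 1).
    { replace (- y / 2) with (- (y / 2)) by field. apply exp_opp_le1. lra. }
    assert (Hex : exp (- x / 2) <= 1).
    { replace (- x / 2) with (- (x / 2)) by field. apply exp_opp_le1. lra. }
    assert (P1 : 0 < Rpower x a * exp (- x)) by (apply Rmult_lt_0_compat; apply exp_pos).
    pose proof (exp_pos (- y / 2)). pose proof (exp_pos (- x / 2)).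
    assert (P2 : 0 < / a) by (now apply Rinv_0_lt_compat).
    apply Rle_trans with (/ a * (Rpower y a * exp (- y) + 2 * C * exp (- x / 2)
        - Rpower x a * exp (- x) - 2 * C * exp (- y / 2))); [right; field; lra|].
    replace (3 * C / a) with (/ a * (3 * C)) by (field; lra).
    apply Rmult_le_compat_l; [lra|]. nra.
Qed.

Lemma is_RInt_gen_Gamma (a : R) : 0 < a ->
  is_RInt_gen (gamma_integrand a) (at_right 0) (Rbar_locally p_infty) (Gamma a).
Proof.
  intros Ha. destruct (ex_gamma_integral a Ha) as [l Hl].
  unfold Gamma. apply (@RInt_gen_correct R_CompleteNormedModule); try typeclasses eauto.
  now exists l.
Qed.

Lemma Gamma_pos (a : R) : 0 < a -> 0 < Gamma a.
Proof.
  intros Ha.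
  apply Rlt_le_trans with (RInt (gamma_integrand a) 1 2).
  - apply RInt_gt_0; [lra | intros; apply gamma_integrand_pos |].
    intros; apply continuous_gamma_integrand; lra.
  - apply RInt_le_gen with (Rbar_locally p_infty) (fun y => 0 < y); try lra.
    + apply Rbar_locally_filter.
    + intros; now apply continuous_gamma_integrand.
    + intros; left; apply gamma_integrand_pos.
    + apply cofinal_in_p_infty.
    + now apply is_RInt_gen_Gamma.
Qed.

Lemma filterlim_Rpower_exp_0 (a : R) : 0 < a ->
  filterlim (fun t => Rpower t a * exp (- t)) (at_right 0) (locally 0).
Proof.
  intros Ha P [eps HP].
  assert (He : 0 < exp (ln eps / a)) by apply exp_pos.
  unfold filtermap. apply (filter_imp (fun t => 0 < t < exp (ln eps / a)));
    [|exact (at_right_0_lt _ He)].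
  intros t [Ht0 Ht]. apply HP. change (Rabs (Rpower t a * exp (- t) - 0) < eps).
  rewrite Rminus_0_r, Rabs_pos_eq
    by (left; apply Rmult_lt_0_compat; apply exp_pos).
  apply Rle_lt_trans with (Rpower t a * 1).
  - apply Rmult_le_compat_l; [left; apply exp_pos|].
    apply exp_opp_le1. lra.
  - rewrite Rmult_1_r. unfold Rpower. rewrite <- (exp_ln eps) by apply cond_pos.
    apply exp_increasing. apply ln_increasing in Ht; [|exact Ht0]. rewrite ln_exp in Ht.
    apply Rmult_lt_compat_l with (r := a) in Ht; [|exact Ha].
    replace (a * (ln eps / a)) with (ln eps) in Ht by (field; lra). exact Ht.
Qed.

Lemma filterlim_Rpower_exp_p_infty (a : R) : 0 < a ->
  filterlim (fun t => Rpower t a * exp (- t)) (Rbar_locally p_infty) (locally 0).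
Proof.
  intros Ha. destruct (Rpower_exp_bound a Ha) as [C [HC HCt]].
  intros P [eps HP].
  exists (Rmax 1 (- 2 * ln (eps / C))). intros t Ht.
  pose proof (Rmax_l 1 (- 2 * ln (eps / C))). pose proof (Rmax_r 1 (- 2 * ln (eps / C))).
  apply HP. change (Rabs (Rpower t a * exp (- t) - 0) < eps).
  rewrite Rminus_0_r, Rabs_pos_eq
    by (left; apply Rmult_lt_0_compat; apply exp_pos).
  eapply Rle_lt_trans; [apply HCt; lra|].
  replace (pos eps) with (C * exp (ln (eps / C))).
  - apply Rmult_lt_compat_l; [exact HC|]. apply exp_increasing. lra.
  - rewrite exp_ln; [field; lra|]. apply Rdiv_lt_0_compat; [apply cond_pos | exact HC].
Qed.

Lemma Gamma_S (a : R) : 0 < a -> Gamma (a + 1) = a * Gamma a.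
Proof.
  intros Ha.
  set (h := fun t => Rpower t a * exp (- t)).
  assert (Hd : forall t, 0 < t -> is_derive h t
                 (a * gamma_integrand a t - gamma_integrand (a + 1) t))
    by (intros; now apply is_derive_Rpower_exp).
  assert (H0 : is_RInt_gen (Derive h) (at_right 0) (Rbar_locally p_infty) (0 - 0)).
  { assert (FP : filter_prod (at_right 0) (Rbar_locally p_infty)
                   (fun ab => 0 < fst ab <= snd ab)).
    { apply filter_prod_right0 with (fun y => 0 < y) 1; [typeclasses eauto | lra |].
      exists 1. intros; lra. }
    apply is_RInt_gen_Derive; try typeclasses eauto.
    - eapply filter_imp; [|exact FP]. intros [x y] Hxy t Ht. simpl in *.
      rewrite Rmin_left in Ht by lra. eexists. apply Hd. lra.
    - eapply filter_imp; [|exact FP]. intros [x y] Hxy t Ht. simpl in *.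
      rewrite Rmin_left in Ht by lra.
      apply continuous_ext_loc with (fun t => a * gamma_integrand a t - gamma_integrand (a + 1) t).
      + assert (Hp : 0 < t) by lra. exists (mkposreal t Hp). intros u Hu.
        symmetry. apply is_derive_unique, Hd. change (Rabs (u - t) < t) in Hu.
        apply Rabs_def2 in Hu. lra.
      + apply (ex_derive_continuous (fun t => a * gamma_integrand a t - gamma_integrand (a + 1) t)).
        unfold gamma_integrand, Rpower. auto_derive. lra.
    - now apply filterlim_Rpower_exp_0.
    - now apply filterlim_Rpower_exp_p_infty. }
  pose proof (is_RInt_gen_minus _ _ _ _
    (is_RInt_gen_scal _ a _ (is_RInt_gen_Gamma a Ha)) (is_RInt_gen_Gamma (a + 1) ltac:(lra))) as H1.
  apply (is_RInt_gen_ext_pos _ (Derive h) _ _ _ _ cofinal_in_p_infty) in H1.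
  - apply (@is_RInt_gen_unique R_CompleteNormedModule) in H0; try typeclasses eauto.
    apply (@is_RInt_gen_unique R_CompleteNormedModule) in H1; try typeclasses eauto.
    rewrite H0 in H1. unfold minus, plus, opp, scal, mult in H1; simpl in H1.
    unfold mult in H1; simpl in H1. lra.
  - intros x Hx. symmetry. exact (is_derive_unique _ _ _ (Hd x Hx)).
Qed.

Lemma Gamma_rising (a : R) (s : nat) : 0 < a -> Gamma (a + INR s) = Gamma a * rising a s.
Proof.
  intros Ha. induction s as [|s IH].
  - simpl. now rewrite Rplus_0_r, Rmult_1_r.
  - rewrite S_INR, <- Rplus_assoc, Gamma_S by (pose proof (pos_INR s); lra).
    rewrite IH. simpl. ring.
Qed.

Lemma Rpower_mult_pow (x b : R) (l : nat) : 0 < x -> x ^ l * Rpower x b = Rpower x (b + INR l).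
Proof. intros Hx. rewrite Rpower_plus, Rpower_pow by exact Hx. ring. Qed.

Lemma gamma_density_pos (a x : R) : 0 < a -> 0 < gamma_density a x.
Proof.
  intros Ha. apply Rdiv_lt_0_compat; [apply gamma_integrand_pos | now apply Gamma_pos].
Qed.

Lemma continuous_gamma_density (a z : R) : 0 < a -> 0 < z -> continuous (gamma_density a) z.
Proof.
  intros Ha Hz. apply (ex_derive_continuous (gamma_density a)).
  pose proof (Gamma_pos a Ha).
  unfold gamma_density, Rpower. auto_derive. repeat split; lra.
Qed.

(** The substitution t = (1 + r) x in the integral of Gamma (a + l). The case r = 0 gives the
    moments, l = 0 the Laplace transform, and r = rho the masses of the mixed Poisson law. *)
Lemma is_RInt_gen_gamma_laplace (a r : R) (l : nat) : 0 < a -> 0 <= r ->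
  is_RInt_gen (fun x => x ^ l * exp (- r * x) * gamma_density a x)
    (at_right 0) (Rbar_locally p_infty) (rising a l * Rpower (1 + r) (- (a + INR l))).
Proof.
  intros Ha Hr. pose proof (pos_INR l) as Hl.
  pose proof (Gamma_pos a Ha) as HG.
  set (b := a + INR l). assert (Hb : 0 < b) by (unfold b; lra).
  pose proof (is_RInt_gen_comp_scal _ (1 + r) _ ltac:(lra) (is_RInt_gen_Gamma b Hb)) as H.
  apply (is_RInt_gen_scal _ (Rpower (1 + r) (- b) / Gamma a)) in H; try typeclasses eauto.
  unfold scal in H; simpl in H; unfold mult in H; simpl in H.
  replace (Rpower (1 + r) (- b) / Gamma a * Gamma b)
    with (rising a l * Rpower (1 + r) (- b)) in H
    by (unfold b; rewrite Gamma_rising by exact Ha; field; lra).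
  revert H. apply (is_RInt_gen_ext_pos _ _ _ _ _ _ cofinal_in_p_infty).
  intros x Hx. unfold gamma_integrand, gamma_density.
  replace (exp (- ((1 + r) * x))) with (exp (- r * x) * exp (- x))
    by (rewrite <- exp_plus; f_equal; ring).
  replace (x ^ l * exp (- r * x) * (Rpower x (a - 1) * exp (- x) / Gamma a))
    with (x ^ l * Rpower x (a - 1) * (exp (- r * x) * exp (- x)) / Gamma a) by (field; lra).
  rewrite Rpower_mult_pow by exact Hx.
  replace (a - 1 + INR l) with (b - 1) by (unfold b; ring).
  rewrite <- Rpower_mult_distr by lra.
  replace (Rpower (1 + r) (- b) / Gamma a * ((1 + r) *
      (Rpower (1 + r) (b - 1) * Rpower x (b - 1) * (exp (- r * x) * exp (- x)))))
    with ((Rpower (1 + r) (- b) * (Rpower (1 + r) (b - 1) * Rpower (1 + r) 1))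
           * (Rpower x (b - 1) * (exp (- r * x) * exp (- x))) / Gamma a)
    by (rewrite (Rpower_1 (1 + r)) by lra; field; lra).
  rewrite <- !Rpower_plus. replace (- b + (b - 1 + 1)) with 0 by ring.
  rewrite Rpower_O by lra. field. lra.
Qed.

(** The negative binomial law with parameters a and 1 / (1 + rho). *)
Lemma mpo_pmf_eq (a rho : R) (l : nat) : 0 < a -> 0 <= rho ->
  mpo_pmf a rho l = rho ^ l / INR (fact l) * (rising a l * Rpower (1 + rho) (- (a + INR l))).
Proof.
  intros Ha Hr. unfold mpo_pmf. f_equal.
  apply (@is_RInt_gen_unique R_CompleteNormedModule); try typeclasses eauto.
  now apply is_RInt_gen_gamma_laplace.
Qed.

Lemma is_RInt_gen_gamma_moment (a : R) (s : nat) : 0 < a ->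
  is_RInt_gen (fun x => x ^ s * gamma_density a x)
    (at_right 0) (Rbar_locally p_infty) (rising a s).
Proof.
  intros Ha. pose proof (is_RInt_gen_gamma_laplace a 0 s Ha (Rle_refl 0)) as H.
  rewrite Rplus_0_r in H. unfold Rpower at 1 in H. rewrite ln_1, Rmult_0_r, exp_0, Rmult_1_r in H.
  revert H. apply (is_RInt_gen_ext_pos _ _ _ _ _ _ cofinal_in_p_infty).
  intros x _. rewrite Ropp_0, Rmult_0_l, exp_0. ring.
Qed.

(** * The generating function *)

Lemma draws_expect_close (w0 b0 al ga n : nat) (f g : nat -> R) (c : R) :
  (1 <= w0)%nat -> (al <= ga)%nat -> (forall k, Rabs (f k - g k) <= c) ->
  Rabs (draws_expect w0 b0 al ga n f - draws_expect w0 b0 al ga n g) <= c.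
Proof.
  intros Hw Hag H. apply Rabs_le. split.
  - apply Rle_trans with (draws_expect w0 b0 al ga n (fun k => 1 * f k + (-1) * g k)).
    + rewrite <- (draws_expect_const w0 b0 al ga n (- c)).
      apply draws_expect_le; try assumption. intros k.
      specialize (H k). apply Rabs_le_between in H. lra.
    + rewrite draws_expect_lin. lra.
  - apply Rle_trans with (draws_expect w0 b0 al ga n (fun k => 1 * f k + (-1) * g k)).
    + rewrite draws_expect_lin. lra.
    + rewrite <- (draws_expect_const w0 b0 al ga n c).
      apply draws_expect_le; try assumption. intros k.
      specialize (H k). apply Rabs_le_between in H. lra.
Qed.

(** On [0,1], (k + 1) (k + 2) / 2 z^k is at most the sum of (j + 1) z^j over j <= k. The
    intermediate bound is the closed form of this sum, multiplied by 2 (1 - z)^2. *)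
Lemma sum_pow_sqr_bound (z : R) (k : nat) : 0 <= z <= 1 ->
  (INR k + 1) * (INR k + 2) * z ^ k * (1 - z) ^ 2 <= 2.
Proof.
  intros Hz.
  assert (H : (INR k + 1) * (INR k + 2) * z ^ k * (1 - z) ^ 2
     <= 2 * (1 - (INR k + 2) * z ^ S k + (INR k + 1) * z ^ S (S k))).
  { induction k as [|m IH]; [simpl; nra|].
    rewrite S_INR. pose proof (pos_INR m) as HM. simpl pow in *.
    set (M := INR m) in *. set (p := z ^ m) in *.
    assert (Hp : 0 <= p) by (apply pow_le; lra).
    assert (0 <= (M + 1) * (M + 2) * (p * (1 - z) * ((1 - z) * (1 - z)))).
    { repeat apply Rmult_le_pos; lra. }
    lra. }
  pose proof (pos_INR k). simpl pow in *. set (p := z ^ k) in *.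
  assert (Hp : 0 <= p) by (apply pow_le; lra).
  assert (Hzp : 0 <= z * p) by (apply Rmult_le_pos; lra).
  assert (z * (z * p) <= z * p) by nra.
  assert ((INR k + 1) * (z * (z * p)) <= (INR k + 1) * (z * p))
    by (apply Rmult_le_compat_l; lra).
  lra.
Qed.

Lemma exp_opp_le_quadratic (y : R) : 0 <= y -> exp (- y) <= 1 - y + y ^ 2.
Proof.
  intros Hy. rewrite exp_Ropp. pose proof (exp_ineq1_le y).
  apply Rle_trans with (/ (1 + y)); [apply Rinv_le_contravar; lra|].
  apply Rmult_le_reg_r with (1 + y); [lra|]. rewrite Rinv_l by lra.
  assert (0 <= y * y * y) by (repeat apply Rmult_le_pos; lra). lra.
Qed.

(** The part r d^2 comes from ln (1 + d) >= d - d^2 and the part r^2 d^2 from exp (- y) <= 1 - y +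
    y^2. Nothing forces r d to be small, as r will be a + k. *)
Lemma Rpower_opp_taylor (d r : R) : 0 <= d -> 0 <= r ->
  0 <= Rpower (1 + d) (- r) - (1 - r * d) <= r * (r + 1) * d ^ 2.
Proof.
  intros Hd Hr. unfold Rpower. set (L := ln (1 + d)).
  assert (HL0 : 0 <= L).
  { unfold L. rewrite <- ln_1. apply ln_le; lra. }
  assert (HL1 : L <= d).
  { unfold L. rewrite <- (ln_exp d) at 2. apply ln_le; [lra | apply exp_ineq1_le]. }
  assert (HL2 : d - d ^ 2 <= L).
  { apply Rle_trans with (1 - / (1 + d)).
    - apply Rmult_le_reg_r with (1 + d); [lra|].
      replace ((1 - / (1 + d)) * (1 + d)) with d by (field; lra).
      assert (0 <= d * d * d) by (repeat apply Rmult_le_pos; lra). lra.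
    - pose proof (exp_ineq1_le (- L)) as H. unfold L in H at 2.
      rewrite exp_Ropp, exp_ln in H by lra. lra. }
  replace (- r * L) with (- (r * L)) by ring.
  set (y := r * L).
  assert (Hy0 : 0 <= y) by (apply Rmult_le_pos; assumption).
  assert (Hy1 : y <= r * d) by (apply Rmult_le_compat_l; assumption).
  assert (Hy2 : r * (d - d ^ 2) <= y) by (apply Rmult_le_compat_l; assumption).
  pose proof (exp_ineq1_le (- y)) as E1.
  pose proof (exp_opp_le_quadratic y Hy0) as E2.
  split; [lra|].
  assert (y ^ 2 <= (r * d) ^ 2) by (apply pow_incr; lra).
  simpl in *. nra.
Qed.

(* Replacing one Bernoulli draw by one step of a pure birth process with the same
   rate, whose generating function has the closed form on the left. *)
Lemma birth_step_close (a t z : R) (k : nat) : 0 < a -> 0 <= t -> 0 <= z <= 1 ->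
  Rabs (z ^ k * Rpower (1 + t * (1 - z)) (- (a + INR k))
        - z ^ k * (1 - t * (a + INR k) * (1 - z))) <= 2 * (1 + a) ^ 2 * t ^ 2.
Proof.
  intros Ha Ht Hz. pose proof (pos_INR k) as Hk.
  set (d := t * (1 - z)). set (r := a + INR k).
  assert (Hd : 0 <= d) by (apply Rmult_le_pos; lra).
  destruct (Rpower_opp_taylor d r Hd ltac:(unfold r; lra)) as [H1 H2].
  replace (t * r * (1 - z)) with (r * d) by (unfold d; ring).
  set (R := Rpower (1 + d) (- r)) in *.
  assert (Hp : 0 <= z ^ k) by (apply pow_le; lra).
  replace (z ^ k * R - z ^ k * (1 - r * d)) with (z ^ k * (R - (1 - r * d))) by ring.
  rewrite Rabs_pos_eq by (apply Rmult_le_pos; assumption).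
  apply Rle_trans with (z ^ k * (r * (r + 1) * d ^ 2)); [now apply Rmult_le_compat_l|].
  pose proof (sum_pow_sqr_bound z k Hz) as HS.
  assert (Hr : r * (r + 1) <= (1 + a) ^ 2 * ((INR k + 1) * (INR k + 2))).
  { replace ((1 + a) ^ 2 * ((INR k + 1) * (INR k + 2)))
      with (((1 + a) * (INR k + 1)) * ((1 + a) * (INR k + 2))) by ring.
    apply Rmult_le_compat; unfold r; nra. }
  apply Rle_trans with (z ^ k * ((1 + a) ^ 2 * ((INR k + 1) * (INR k + 2)) * d ^ 2)).
  { apply Rmult_le_compat_l; [exact Hp|]. apply Rmult_le_compat_r; [|exact Hr].
    apply pow2_ge_0. }
  unfold d.
  replace (z ^ k * ((1 + a) ^ 2 * ((INR k + 1) * (INR k + 2)) * (t * (1 - z)) ^ 2))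
    with ((1 + a) ^ 2 * t ^ 2 * ((INR k + 1) * (INR k + 2) * z ^ k * (1 - z) ^ 2)) by ring.
  replace (2 * (1 + a) ^ 2 * t ^ 2) with ((1 + a) ^ 2 * t ^ 2 * 2) by ring.
  apply Rmult_le_compat_l; [|exact HS].
  apply Rmult_le_pos; apply pow2_ge_0.
Qed.

(** The difference of the inverses is ga / (T (T + ga)), and T + ga <= 2 ga T because T and ga are
    at least 1. *)
Lemma white_rate_sqr_telescope (w0 b0 al ga n : nat) : (1 <= w0)%nat -> (1 <= ga)%nat ->
  white_rate w0 b0 al ga n ^ 2 <=
  2 * INR al ^ 2 * (/ urn_total w0 b0 ga n - / urn_total w0 b0 ga (S n)).
Proof.
  intros Hw Hg. unfold white_rate. rewrite urn_total_S.
  pose proof (urn_total_ge w0 b0 ga n) as HT. apply le_INR in Hw, Hg. simpl in Hw, Hg.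
  pose proof (pos_INR b0). set (T := urn_total w0 b0 ga n) in *.
  replace ((INR al / T) ^ 2) with (INR al ^ 2 * / T ^ 2) by (field; lra).
  rewrite (Rmult_comm 2), (Rmult_assoc (INR al ^ 2)).
  apply Rmult_le_compat_l; [apply pow2_ge_0|].
  apply Rmult_le_reg_r with (T ^ 2 * (T + INR ga)); [simpl; nra|].
  replace (/ T ^ 2 * (T ^ 2 * (T + INR ga))) with (T + INR ga) by (field; lra).
  replace (2 * (/ T - / (T + INR ga)) * (T ^ 2 * (T + INR ga))) with (2 * INR ga * T)
    by (field; lra).
  nra.
Qed.

(** One birth step sends z to z' = z / (1 + d) and contributes the factor (1 + d)^(- a) <= 1, so the
    induction runs over all z at once and the errors of the steps add up without being enlarged. *)
Lemma draws_pgf_close (w0 b0 al ga n : nat) (z : R) :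
  (1 <= al)%nat -> (1 <= w0)%nat -> (al <= ga)%nat -> 0 <= z <= 1 ->
  Rabs (draws_expect w0 b0 al ga n (fun k => z ^ k)
        - Rpower (1 + (urn_growth w0 b0 al ga n - 1) * (1 - z)) (- (INR w0 / INR al)))
  <= 4 * INR al ^ 2 * (1 + INR w0 / INR al) ^ 2
     * (/ urn_total w0 b0 ga 0 - / urn_total w0 b0 ga n).
Proof.
  intros Hal Hw Hag. pose proof (white_share_pos w0 al Hal Hw) as Ha.
  set (a := INR w0 / INR al) in *. set (C := 4 * INR al ^ 2 * (1 + a) ^ 2).
  revert z. induction n as [|n IH]; intros z Hz.
  { rewrite draws_expect_0. simpl urn_growth.
    replace (1 + (1 - 1) * (1 - z)) with 1 by ring.
    unfold Rpower. rewrite ln_1, Rmult_0_r, exp_0. simpl (z ^ 0).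
    rewrite !Rminus_diag, Rabs_R0. lra. }
  set (t := white_rate w0 b0 al ga n).
  assert (Ht : 0 <= t) by apply white_rate_ge0.
  set (d := t * (1 - z)). assert (Hd : 0 <= d) by (apply Rmult_le_pos; lra).
  set (z' := z / (1 + d)).
  assert (Hz' : 0 <= z' <= 1).
  { split; [apply Rdiv_le_0_compat; lra|].
    unfold z'. apply Rmult_le_reg_r with (1 + d); [lra|]. field_simplify; lra. }
  pose proof (urn_total_pos w0 b0 ga n Hw) as HT.
  assert (Hal0 : 0 < INR al) by (apply lt_0_INR; lia).
  assert (E1 : Rabs (draws_expect w0 b0 al ga (S n) (fun k => z ^ k)
     - Rpower (1 + d) (- a) * draws_expect w0 b0 al ga n (fun k => z' ^ k))
     <= 2 * (1 + a) ^ 2 * t ^ 2).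
  { rewrite draws_expect_S, <- draws_expect_scal.
    apply draws_expect_close; try assumption. intros k.
    rewrite Rabs_minus_sym.
    replace (Rpower (1 + d) (- a) * z' ^ k)
      with (z ^ k * Rpower (1 + t * (1 - z)) (- (a + INR k))).
    2:{ fold d. unfold z', Rdiv. rewrite Rpow_mult_distr, Ropp_plus_distr, Rpower_plus.
        rewrite (Rpower_Ropp _ (INR k)), Rpower_pow, pow_inv by lra. ring. }
    replace (z ^ k + (INR w0 + INR al * INR k) / urn_total w0 b0 ga n * (z ^ S k - z ^ k))
      with (z ^ k * (1 - t * (a + INR k) * (1 - z)))
      by (simpl pow; unfold t, white_rate, a; field; lra).
    now apply birth_step_close. }
  set (g := urn_growth w0 b0 al ga n - 1) in *.
  assert (Hg : 0 <= g) by (pose proof (urn_growth_ge1 w0 b0 al ga n); unfold g; lra).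
  (* The negative binomial form is preserved: (1 + d) (1 + g (1 - z')) = 1 + g_(n+1) (1 - z). *)
  assert (E2 : Rpower (1 + (urn_growth w0 b0 al ga (S n) - 1) * (1 - z)) (- a) =
     Rpower (1 + d) (- a) * Rpower (1 + g * (1 - z')) (- a)).
  { rewrite Rpower_mult_distr; [|lra|].
    2:{ assert (0 <= g * (1 - z')) by (apply Rmult_le_pos; lra). lra. }
    f_equal. simpl urn_growth. fold t. unfold z', g, d. field.
    fold d. lra. }
  specialize (IH z' Hz').
  assert (Hw1 : Rpower (1 + d) (- a) <= 1).
  { unfold Rpower. rewrite Ropp_mult_distr_l_reverse. apply exp_opp_le1.
    apply Rmult_le_pos; [lra|]. rewrite <- ln_1. apply ln_le; lra. }
  assert (Hw0 : 0 <= Rpower (1 + d) (- a)) by (left; apply exp_pos).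
  rewrite E2.
  set (w := Rpower (1 + d) (- a)) in *.
  set (G := draws_expect w0 b0 al ga n (fun k => z' ^ k)) in *.
  set (Q := Rpower (1 + g * (1 - z')) (- a)) in *.
  replace (draws_expect w0 b0 al ga (S n) (fun k => z ^ k) - w * Q)
    with ((draws_expect w0 b0 al ga (S n) (fun k => z ^ k) - w * G) + w * (G - Q)) by ring.
  eapply Rle_trans; [apply Rabs_triang|].
  rewrite Rabs_mult, (Rabs_pos_eq w) by assumption.
  assert (w * Rabs (G - Q) <= Rabs (G - Q)).
  { pose proof (Rabs_pos (G - Q)). nra. }
  pose proof (white_rate_sqr_telescope w0 b0 al ga n Hw ltac:(lia)) as HS. fold t in HS.
  apply Rmult_le_compat_l with (r := 2 * (1 + a) ^ 2) in HS;
    [|pose proof (pow2_ge_0 (1 + a)); lra].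
  unfold C in *. lra.
Qed.

(** * The mixed Poisson law *)

Lemma is_series_ext_R (u v : nat -> R) (l : R) :
  (forall n, u n = v n) -> is_series u l -> is_series v l.
Proof. exact (is_series_ext u v l). Qed.

(** The coefficients of (1 - x)^(- a). *)
Definition binom_coef (a : R) (l : nat) : R := rising a l / INR (fact l).

Lemma binom_coef_S (a : R) (l : nat) :
  INR (S l) * binom_coef a (S l) = (a + INR l) * binom_coef a l.
Proof.
  unfold binom_coef. rewrite fact_simpl, mult_INR. simpl rising.
  field. split; [apply INR_fact_neq_0 | apply not_0_INR; lia].
Qed.

Lemma binom_coef_pos (a : R) (l : nat) : 0 < a -> 0 < binom_coef a l.
Proof.
  intros Ha. apply Rdiv_lt_0_compat; [now apply rising_pos | apply INR_fact_lt_0].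
Qed.

Lemma CV_radius_binom (a : R) : 0 < a -> CV_radius (binom_coef a) = 1.
Proof.
  intros Ha. replace (Finite 1) with (Finite (/ 1)) by (f_equal; field).
  apply CV_radius_finite_DAlembert; [|lra|].
  - intros n. pose proof (binom_coef_pos a n Ha). lra.
  - apply is_lim_seq_ext with (fun n => 1 + (a - 1) / INR (S n)).
    + intros n. pose proof (binom_coef_pos a n Ha) as H. pose proof (pos_INR n).
      rewrite Rabs_pos_eq.
      2:{ left. apply Rdiv_lt_0_compat; now apply binom_coef_pos. }
      pose proof (binom_coef_S a n) as HS. rewrite S_INR in *.
      apply Rmult_eq_reg_r with ((INR n + 1) * binom_coef a n); [|nra].
      transitivity ((a + INR n) * binom_coef a n); [field; lra|].
      rewrite <- HS. field. lra.
    + replace (Finite 1) with (Finite (1 + (a - 1) * 0)) by (f_equal; ring).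
      apply is_lim_seq_plus'; [apply is_lim_seq_const|].
      apply (is_lim_seq_scal_l (fun n => / INR (S n)) (a - 1) 0).
      replace (Finite 0) with (Rbar_inv p_infty) by reflexivity.
      apply is_lim_seq_inv; [|discriminate].
      apply (is_lim_seq_incr_1 INR). apply is_lim_seq_INR.
Qed.

(* The sum [F] satisfies [(1 - x) F' = a F], so [F (1 - x)^a] is constant. *)
Lemma binom_series (a x : R) : 0 < a -> 0 <= x < 1 ->
  is_series (fun l => binom_coef a l * x ^ l) (Rpower (1 - x) (- a)).
Proof.
  intros Ha Hx. set (c := binom_coef a).
  assert (Hin : forall y, 0 <= y < 1 -> Rbar_lt (Rabs y) (CV_radius c)).
  { intros y Hy. unfold c. rewrite CV_radius_binom by exact Ha.
    rewrite Rabs_pos_eq by lra. simpl. lra. }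
  set (F := PSeries c).
  assert (HF' : forall y, 0 <= y < 1 -> PSeries (PS_derive c) y * (1 - y) = a * F y).
  { intros y Hy.
    assert (E : PSeries (PS_derive c) y =
                PSeries (PS_plus (PS_scal a c) (PS_incr_1 (PS_derive c))) y).
    { apply PSeries_ext. intros n. unfold PS_derive at 1. unfold c at 1.
      rewrite binom_coef_S. unfold PS_plus, PS_scal, PS_incr_1, plus, scal; simpl.
      unfold mult; simpl. destruct n as [|n].
      - simpl. fold c. unfold zero; simpl. ring.
      - unfold PS_derive, c. ring. }
    rewrite PSeries_plus in E.
    - rewrite PSeries_scal, PSeries_incr_1 in E. unfold F. lra.
    - apply ex_pseries_scal; [apply Rmult_comm | apply CV_radius_inside, Hin, Hy].
    - apply ex_pseries_incr_1, CV_radius_inside. rewrite CV_radius_derive. now apply Hin. }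
  assert (HF : F x = Rpower (1 - x) (- a)).
  { set (h := fun y => F y * Rpower (1 - y) a).
    assert (Hh : h 0 = 1).
    { unfold h, F. rewrite PSeries_0, Rminus_0_r. unfold c, binom_coef, Rpower.
      rewrite ln_1, Rmult_0_r, exp_0. simpl. field. }
    assert (Hx1 : h x = 1).
    { destruct (Rle_lt_or_eq_dec 0 x (proj1 Hx)) as [H0|<-]; [|exact Hh].
      rewrite <- Hh. symmetry. apply (eq_is_derive h); [|exact H0].
      intros t Ht. unfold h.
      pose proof (is_derive_PSeries c t (Hin t ltac:(lra))) as D1. fold F in D1.
      assert (D2 : is_derive (fun y => Rpower (1 - y) a) t (- (a * Rpower (1 - t) (a - 1)))).
      { unfold Rpower. auto_derive; [lra|].
        replace ((a - 1) * ln (1 - t)) with (a * ln (1 - t) + - ln (1 - t)) by ring.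
        rewrite exp_plus, (exp_Ropp (ln (1 - t))), exp_ln by lra. unfold Rminus. field. lra. }
      pose proof (is_derive_mult _ _ _ _ _ D1 D2 Rmult_comm) as D.
      unfold plus, mult in D; simpl in D.
      replace (@zero R_NormedModule) with
        (PSeries (PS_derive c) t * Rpower (1 - t) a + F t * - (a * Rpower (1 - t) (a - 1)));
        [exact D|].
      replace (Rpower (1 - t) a) with (Rpower (1 - t) (a - 1) * (1 - t)).
      2:{ rewrite <- (Rpower_1 (1 - t)) at 2 by lra. rewrite <- Rpower_plus. f_equal. ring. }
      specialize (HF' t ltac:(lra)). unfold zero; simpl.
      transitivity (Rpower (1 - t) (a - 1) * (PSeries (PS_derive c) t * (1 - t) - a * F t)); [ring|].
      rewrite HF'. ring. }
    unfold h in Hx1. rewrite Rpower_Ropp.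
    pose proof (exp_pos (a * ln (1 - x))) as Hp. fold (Rpower (1 - x) a) in Hp.
    apply Rmult_eq_reg_r with (Rpower (1 - x) a); [|lra].
    rewrite Hx1, Rinv_l; lra. }
  rewrite <- HF. apply is_pseries_R, PSeries_correct, CV_radius_inside, Hin, Hx.
Qed.

(** The binomial series at x = rho z / (1 + rho), for which (1 + rho) (1 - x) = 1 + rho (1 - z). As
    x < 1 also for z = 1, the total mass is included. *)
Lemma mpo_pgf (a rho z : R) : 0 < a -> 0 < rho -> 0 <= z <= 1 ->
  is_series (fun l => mpo_pmf a rho l * z ^ l) (Rpower (1 + rho * (1 - z)) (- a)).
Proof.
  intros Ha Hr Hz.
  set (x := rho * z / (1 + rho)).
  assert (Hx : 0 <= x < 1).
  { split; [apply Rdiv_le_0_compat; nra|].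
    unfold x. apply Rmult_lt_reg_r with (1 + rho); [lra|].
    unfold Rdiv. rewrite Rmult_assoc, Rinv_l by lra. nra. }
  pose proof (is_series_scal (Rpower (1 + rho) (- a)) _ _ (binom_series a x Ha Hx)) as H.
  unfold scal in H; simpl in H; unfold mult in H; simpl in H.
  rewrite Rpower_mult_distr in H by lra.
  replace ((1 + rho) * (1 - x)) with (1 + rho * (1 - z)) in H by (unfold x; field; lra).
  revert H. apply is_series_ext_R. intros l.
  rewrite mpo_pmf_eq by lra. unfold binom_coef, x.
  rewrite Ropp_plus_distr, Rpower_plus, (Rpower_Ropp _ (INR l)), Rpower_pow by lra.
  unfold Rdiv. rewrite !Rpow_mult_distr, pow_inv. ring.
Qed.

Lemma mpo_pmf_pos (a rho : R) (l : nat) : 0 < a -> 0 < rho -> 0 < mpo_pmf a rho l.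
Proof.
  intros Ha Hr. rewrite mpo_pmf_eq by lra.
  apply Rmult_lt_0_compat; [|apply Rmult_lt_0_compat; [now apply rising_pos | apply exp_pos]].
  apply Rdiv_lt_0_compat; [now apply pow_lt | apply INR_fact_lt_0].
Qed.

(** Size-biasing raises the Gamma shape by 1. It reduces the factorial moment of order j + 1 for the
    shape a to the one of order j for a + 1. *)
Lemma mpo_pmf_S (a rho : R) (l : nat) : 0 < a -> 0 < rho ->
  INR (S l) * mpo_pmf a rho (S l) = rho * a * mpo_pmf (a + 1) rho l.
Proof.
  intros Ha Hr. rewrite !mpo_pmf_eq by lra.
  rewrite fact_simpl, mult_INR.
  replace (a + 1 + INR l) with (a + INR (S l)) by (rewrite S_INR; ring).
  change (rising a (S l)) with (rising a l * (a + INR l)). rewrite <- rising_S.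
  simpl pow. field. split; [apply INR_fact_neq_0 | apply not_0_INR; lia].
Qed.

Lemma falling_0_S (j : nat) : falling 0 (S j) = 0.
Proof.
  induction j as [|j IH]; [simpl; ring|].
  change (falling 0 (S j) * (0 - INR (S j)) = 0). rewrite IH. ring.
Qed.

Lemma mpo_factorial_moment (a rho : R) (j : nat) : 0 < a -> 0 < rho ->
  is_series (fun l => falling (INR l) j * mpo_pmf a rho l) (rho ^ j * rising a j).
Proof.
  intros Ha Hr. revert a Ha. induction j as [|j IH]; intros a Ha.
  - pose proof (mpo_pgf a rho 1 Ha Hr ltac:(lra)) as H.
    replace (rho ^ 0 * rising a 0) with (Rpower (1 + rho * (1 - 1)) (- a)).
    + revert H. apply is_series_ext_R. intros l. rewrite pow1. simpl. ring.
    + replace (1 + rho * (1 - 1)) with 1 by ring.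
      unfold Rpower. rewrite ln_1, Rmult_0_r, exp_0. simpl. ring.
  - pose proof (is_series_scal (rho * a) _ _ (IH (a + 1) ltac:(lra))) as H.
    unfold scal in H; simpl in H; unfold mult in H; simpl in H.
    apply is_series_decr_1.
    change (is_series (fun l => falling (INR (S l)) (S j) * mpo_pmf a rho (S l))
      (rho * rho ^ j * (rising a j * (a + INR j)) + - (falling 0 (S j) * mpo_pmf a rho 0))).
    rewrite falling_0_S, <- rising_S, Rmult_0_l, Ropp_0, Rplus_0_r.
    replace (rho * rho ^ j * (a * rising (a + 1) j))
      with (rho * a * (rho ^ j * rising (a + 1) j)) by ring.
    revert H. apply is_series_ext_R. intros l.
    replace (falling (INR (S l)) (S j)) with (INR (S l) * falling (INR l) j).
    + transitivity (falling (INR l) j * (INR (S l) * mpo_pmf a rho (S l))); [|ring].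
      rewrite mpo_pmf_S by assumption. ring.
    + rewrite S_INR.
      change (falling (INR l + 1) (S j)) with (falling (INR l + 1) j * (INR l + 1 - INR j)).
      rewrite <- falling_S. ring.
Qed.

(** * Powers through falling factorials *)

Fixpoint stirling2 (s j : nat) : R :=
  match s with
  | O => match j with O => 1 | S _ => 0 end
  | S s' => INR j * stirling2 s' j + match j with O => 0 | S i => stirling2 s' i end
  end.

Lemma stirling2_gt (s j : nat) : (s < j)%nat -> stirling2 s j = 0.
Proof.
  revert j. induction s as [|s IH]; intros j Hj; destruct j as [|j]; try lia; [reflexivity|].
  simpl stirling2. rewrite !IH by lia. ring.
Qed.

Lemma stirling2_diag (s : nat) : stirling2 s s = 1.
Proof.
  induction s as [|s IH]; [reflexivity|].
  simpl stirling2. rewrite IH, stirling2_gt by lia. ring.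
Qed.

Lemma pow_falling (x : R) (s : nat) :
  x ^ s = sum_f_R0 (fun j => stirling2 s j * falling x j) s.
Proof.
  induction s as [|s IH]; [simpl; ring|].
  transitivity (sum_f_R0 (fun j => INR j * stirling2 s j * falling x j) (S s)
    + sum_f_R0 (fun j => match j with O => 0 | S i => stirling2 s i * falling x (S i) end) (S s)).
  - rewrite tech5, stirling2_gt, (decomp_sum (fun j => match j with O => 0 | S i => _ end)) by lia.
    simpl Nat.pred. rewrite Rmult_0_r, Rmult_0_l, Rplus_0_r, Rplus_0_l, <- plus_sum.
    simpl pow. rewrite IH, scal_sum. apply sum_eq. intros j _. simpl falling. ring.
  - rewrite <- plus_sum. apply sum_eq. intros j _. destruct j; cbn [stirling2]; ring.
Qed.

(** * Convergence of the mass function *)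

Lemma power_series_bound (d : nat -> R) (z D : R) :
  (forall k, Rabs (d k) <= 1) -> 0 < z < 1 ->
  is_series (fun k => d k * z ^ k) D -> Rabs D <= / (1 - z).
Proof.
  intros Hd Hz HD.
  assert (Hg : is_series (fun k => z ^ k) (/ (1 - z)))
    by (apply is_series_geom; rewrite Rabs_pos_eq; lra).
  assert (Hle : forall k, 0 <= Rabs (d k * z ^ k) <= z ^ k).
  { intros k. split; [apply Rabs_pos|]. rewrite Rabs_mult.
    assert (0 <= z ^ k) by (apply pow_le; lra).
    rewrite (Rabs_pos_eq (z ^ k)) by assumption.
    specialize (Hd k). nra. }
  assert (Hex : ex_series (fun k => Rabs (d k * z ^ k))).
  { apply (@ex_series_le R_AbsRing R_CompleteNormedModule) with (fun k => z ^ k).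
    - intros k. unfold norm; simpl. unfold abs; simpl. rewrite Rabs_Rabsolu. apply Hle.
    - now exists (/ (1 - z)). }
  rewrite <- (is_series_unique _ _ HD), <- (is_series_unique _ _ Hg).
  eapply Rle_trans; [now apply Series_Rabs|].
  apply Series_le; [exact Hle | now exists (/ (1 - z))].
Qed.

Lemma power_series_tail (d : nat -> R) (z D : R) : 0 < z ->
  is_series (fun k => d k * z ^ k) D -> is_series (fun k => d (S k) * z ^ k) ((D - d 0%nat) / z).
Proof.
  intros Hz HD.
  assert (H : is_series (fun k => d (S k) * z ^ S k) (D - d 0%nat)).
  { apply (is_series_incr_1 (fun k => d k * z ^ k)).
    change (is_series (fun k => d k * z ^ k) (D - d 0%nat + d 0%nat * 1)).
    replace (D - d 0%nat + d 0%nat * 1) with D by ring. exact HD. }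
  apply (is_series_scal (/ z)) in H. unfold scal in H; simpl in H; unfold mult in H; simpl in H.
  replace ((D - d 0%nat) / z) with (/ z * (D - d 0%nat)) by (unfold Rdiv; ring).
  revert H. apply is_series_ext_R. intros k. field. lra.
Qed.

(** Apart from the constant term, the series is at most z / (1 - z) in absolute value, uniformly in
    n, so a small z is fixed before n grows. *)
Lemma coef0_cvg_0 (d : nat -> nat -> R) (D : nat -> R -> R) :
  (forall n k, Rabs (d n k) <= 1) ->
  (forall n z, 0 < z < 1 -> is_series (fun k => d n k * z ^ k) (D n z)) ->
  (forall z, 0 < z < 1 -> is_lim_seq (fun n => D n z) 0) ->
  is_lim_seq (fun n => d n 0%nat) 0.
Proof.
  intros Hd HD HL.
  apply is_lim_seq_spec. intros eps. pose proof (cond_pos eps) as He.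
  (* The solution of z / (1 - z) = eps / 2. *)
  set (z := eps / (2 + eps)).
  assert (Hz : 0 < z < 1).
  { split; [apply Rdiv_lt_0_compat; lra|]. unfold z.
    apply Rmult_lt_reg_r with (2 + eps); [lra|]. field_simplify; lra. }
  assert (Ez : z * / (1 - z) = eps / 2) by (unfold z; field; lra).
  assert (He2 : 0 < eps / 2) by lra.
  pose proof (HL z Hz) as HLz. apply is_lim_seq_spec in HLz.
  destruct (HLz (mkposreal _ He2)) as [N HN]. exists N. intros n Hn.
  specialize (HN n Hn). simpl in HN. rewrite Rminus_0_r in *.
  pose proof (power_series_bound (fun k => d n (S k)) z _ (fun k => Hd n (S k)) Hz
    (power_series_tail _ z _ (proj1 Hz) (HD n z Hz))) as HB.
  set (X := (D n z - d n 0%nat) / z) in *.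
  replace (d n 0%nat) with (D n z + - (z * X)) by (unfold X; field; lra).
  eapply Rle_lt_trans; [apply Rabs_triang|].
  rewrite Rabs_Ropp, Rabs_mult, (Rabs_pos_eq z) by lra.
  assert (z * Rabs X <= z * / (1 - z)) by (apply Rmult_le_compat_l; lra).
  lra.
Qed.

(** Subtracting the constant term and dividing by z shifts the coefficients by one and preserves all
    hypotheses; z stays away from 0 for this. *)
Lemma coef_cvg_0 (d : nat -> nat -> R) (D : nat -> R -> R) (l : nat) :
  (forall n k, Rabs (d n k) <= 1) ->
  (forall n z, 0 < z < 1 -> is_series (fun k => d n k * z ^ k) (D n z)) ->
  (forall z, 0 < z < 1 -> is_lim_seq (fun n => D n z) 0) ->
  is_lim_seq (fun n => d n l) 0.
Proof.
  revert d D. induction l as [|l IH]; intros d D Hd HD HL; [now apply (coef0_cvg_0 d D)|].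
  apply (IH (fun n k => d n (S k)) (fun n z => (D n z - d n 0%nat) / z)).
  - intros; apply Hd.
  - intros n z Hz. apply power_series_tail; [lra | now apply HD].
  - intros z Hz. replace (Finite 0) with (Finite ((0 - 0) * / z)) by (f_equal; field; lra).
    apply (is_lim_seq_scal_r _ (/ z) (0 - 0)).
    apply is_lim_seq_minus'; [now apply HL | now apply (coef0_cvg_0 d D)].
Qed.

Lemma sum_f_R0_stationary (u : nat -> R) (N n : nat) :
  (forall k, (N < k)%nat -> u k = 0) -> (N <= n)%nat -> sum_f_R0 u n = sum_f_R0 u N.
Proof.
  intros Hu. induction 1 as [|n Hn IH]; [reflexivity|].
  rewrite tech5, IH, Hu by lia. ring.
Qed.

Lemma is_series_stationary (u : nat -> R) (N : nat) :
  (forall k, (N < k)%nat -> u k = 0) -> is_series u (sum_f_R0 u N).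
Proof.
  intros Hu. change (is_lim_seq (sum_n u) (sum_f_R0 u N)).
  apply is_lim_seq_ext_loc with (fun _ => sum_f_R0 u N); [|apply is_lim_seq_const].
  exists N. intros n Hn. rewrite sum_n_Reals. symmetry. now apply sum_f_R0_stationary.
Qed.

Lemma is_lim_seq_sum_f_R0 (u : nat -> nat -> R) (l : nat -> R) (N : nat) :
  (forall k, is_lim_seq (fun n => u n k) (l k)) ->
  is_lim_seq (fun n => sum_f_R0 (u n) N) (sum_f_R0 l N).
Proof.
  intros H. induction N as [|N IH]; simpl; [apply H|]. now apply is_lim_seq_plus'.
Qed.

Lemma urn_law_le1 (w0 b0 al ga n k : nat) : (1 <= w0)%nat -> (al <= ga)%nat ->
  urn_law w0 b0 al ga n k <= 1.
Proof.
  intros Hw Hag. destruct (Nat.lt_ge_cases n k) as [Hn|Hn].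
  { rewrite urn_law_gt by assumption. lra. }
  rewrite <- (draws_expect_const w0 b0 al ga n 1).
  apply Rle_trans with (draws_expect w0 b0 al ga n (fun j => if Nat.eqb j k then 1 else 0)).
  - right. symmetry.
    assert (H : forall m, (k <= m)%nat -> sum_f_R0 (fun j => urn_law w0 b0 al ga n j *
        (if Nat.eqb j k then 1 else 0)) m = urn_law w0 b0 al ga n k).
    { intros m Hm. rewrite (sum_f_R0_stationary _ k m); [|intros j Hj|exact Hm].
      - destruct k as [|k]; [simpl; ring|].
        rewrite tech5, Nat.eqb_refl, sum_eq_R0; [ring|].
        intros j Hj. destruct (Nat.eqb_spec j (S k)); [lia | ring].
      - destruct (Nat.eqb_spec j k); [lia | ring]. }
    now apply H.
  - apply draws_expect_le; try assumption. intros j. destruct (Nat.eqb j k); lra.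
Qed.

Lemma Rpower_cont_seq (u : nat -> R) (l b : R) : 0 <= l ->
  is_lim_seq u l -> is_lim_seq (fun n => Rpower (1 + u n) b) (Rpower (1 + l) b).
Proof.
  intros Hl Hu. apply (is_lim_seq_continuous (fun y => Rpower (1 + y) b)); [|exact Hu].
  apply continuity_pt_filterlim. apply (ex_derive_continuous (fun y => Rpower (1 + y) b)).
  unfold Rpower. auto_derive. lra.
Qed.

(** The point z may move with n: a constant z is used when [lam] converges, and z = exp (- m / lam)
    when it diverges. *)
Lemma draws_pgf_lim (al be ga w0 : nat) (b : nat -> nat) (z : nat -> R) (l : R) :
  (1 <= al)%nat -> (1 <= w0)%nat -> ga = (al + be)%nat ->
  is_lim_seq (fun n => INR (b n)) p_infty ->
  eventually (fun n => 0 <= z n <= 1) -> 0 <= l ->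
  is_lim_seq (fun n => lam al ga n (b n) * (1 - z n)) l ->
  is_lim_seq (fun n => draws_expect w0 (b n) al ga n (fun k => z n ^ k))
    (Rpower (1 + l) (- (INR w0 / INR al))).
Proof.
  intros Hal Hw Hga Hb Hz Hl0 Hl. set (a := INR w0 / INR al).
  assert (H1 : is_lim_seq (fun n => (urn_growth w0 (b n) al ga n - 1) * (1 - z n)) l).
  { pose proof (is_lim_seq_mult' _ _ _ _ (growth_lam_ratio al be ga w0 b Hal Hga Hb) Hl) as H.
    rewrite Rmult_1_l in H. eapply is_lim_seq_ext_loc; [|exact H].
    destruct (is_lim_seq_INR_large b 0 Hb) as [N HN].
    exists (Nat.max 1 N). intros n Hn. specialize (HN n ltac:(lia)).
    pose proof (lam_pos al be ga (b n) n Hal Hga ltac:(lia) ltac:(lia)). field. lra. }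
  apply (Rpower_cont_seq _ l (- a) Hl0) in H1.
  set (C := 4 * INR al ^ 2 * (1 + a) ^ 2).
  assert (HC : 0 <= C).
  { unfold C. apply Rmult_le_pos; [|apply pow2_ge_0]. pose proof (pow2_ge_0 (INR al)). lra. }
  assert (H2 : is_lim_seq (fun n => draws_expect w0 (b n) al ga n (fun k => z n ^ k)
     - Rpower (1 + (urn_growth w0 (b n) al ga n - 1) * (1 - z n)) (- a)) 0).
  { apply is_lim_seq_abs_0. apply is_lim_seq_le_le_loc with
      (u := fun _ => 0) (w := fun n => C / INR (b n)).
    - destruct (is_lim_seq_INR_large b 0 Hb) as [N HN]. destruct Hz as [N' HN'].
      exists (Nat.max N N'). intros n Hn. specialize (HN n ltac:(lia)). specialize (HN' n ltac:(lia)).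
      split; [apply Rabs_pos|].
      eapply Rle_trans; [apply (draws_pgf_close w0 (b n) al ga n (z n) Hal Hw ltac:(lia) HN')|].
      fold a. fold C. apply Rmult_le_compat_l; [exact HC|].
      pose proof (urn_total_pos w0 (b n) ga n Hw) as HT. apply Rinv_0_lt_compat in HT.
      pose proof (urn_total_ge w0 (b n) ga 0). pose proof (pos_INR w0).
      assert (0 < INR (b n)) by (apply lt_0_INR; lia).
      assert (/ urn_total w0 (b n) ga 0 <= / INR (b n)) by (apply Rinv_le_contravar; lra).
      lra.
    - apply is_lim_seq_const.
    - now apply is_lim_seq_scal_inv. }
  pose proof (is_lim_seq_plus' _ _ _ _ H2 H1) as H. rewrite Rplus_0_l in H.
  eapply is_lim_seq_ext; [|exact H]. intros n. simpl. ring.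
Qed.

Lemma urn_law_cvg (al be ga w0 : nat) (b : nat -> nat) (rho : R) (l : nat) :
  (1 <= al)%nat -> (1 <= w0)%nat -> ga = (al + be)%nat ->
  is_lim_seq (fun n => INR (b n)) p_infty -> 0 < rho ->
  is_lim_seq (fun n => lam al ga n (b n)) rho ->
  is_lim_seq (fun n => urn_law w0 (b n) al ga n l) (mpo_pmf (INR w0 / INR al) rho l).
Proof.
  intros Hal Hw Hga Hb Hrho Hl. set (a := INR w0 / INR al).
  pose proof (white_share_pos w0 al Hal Hw) as Ha. fold a in Ha.
  set (d := fun n k => urn_law w0 (b n) al ga n k - mpo_pmf a rho k).
  (* The masses are positive and sum to 1 by the generating function at z = 1. With this the
     differences [d n k] lie in [-1, 1], as [coef_cvg_0] requires. *)
  assert (Hpmf : forall k, 0 <= mpo_pmf a rho k <= 1).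
  { intros k. split; [left; now apply mpo_pmf_pos|].
    pose proof (mpo_pgf a rho 1 Ha Hrho ltac:(lra)) as H.
    replace (Rpower (1 + rho * (1 - 1)) (- a)) with 1 in H.
    2:{ replace (1 + rho * (1 - 1)) with 1 by ring.
        unfold Rpower. now rewrite ln_1, Rmult_0_r, exp_0. }
    assert (Hs : forall m, mpo_pmf a rho m <= sum_f_R0 (mpo_pmf a rho) m).
    { intros [|m]; [simpl; lra|]. rewrite tech5.
      assert (0 <= sum_f_R0 (mpo_pmf a rho) m)
        by (apply cond_pos_sum; intros; left; now apply mpo_pmf_pos). lra. }
    eapply Rle_trans; [apply Hs|].
    apply (is_lim_seq_incr_compare (fun m => sum_f_R0 (mpo_pmf a rho) m)).
    - eapply is_lim_seq_ext; [|exact H]. intros m. rewrite sum_n_Reals.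
      apply sum_eq. intros j _. rewrite pow1. ring.
    - intros m. rewrite tech5. pose proof (mpo_pmf_pos a rho (S m) Ha Hrho). lra. }
  assert (Hd0 : is_lim_seq (fun n => d n l) 0).
  { apply coef_cvg_0 with (D := fun n z =>
      draws_expect w0 (b n) al ga n (fun k => z ^ k) - Rpower (1 + rho * (1 - z)) (- a)).
    - intros n k. unfold d. specialize (Hpmf k).
      pose proof (urn_law_ge0 w0 (b n) al ga n k Hw ltac:(lia)).
      pose proof (urn_law_le1 w0 (b n) al ga n k Hw ltac:(lia)).
      apply Rabs_le. lra.
    - intros n z Hz.
      assert (H1 : is_series (fun k => urn_law w0 (b n) al ga n k * z ^ k)
                     (draws_expect w0 (b n) al ga n (fun k => z ^ k))).
      { apply (is_series_stationary (fun k => urn_law w0 (b n) al ga n k * z ^ k)).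
        intros k Hk. rewrite urn_law_gt by assumption. ring. }
      pose proof (is_series_minus _ _ _ _ H1 (mpo_pgf a rho z Ha Hrho ltac:(lra))) as H.
      revert H. apply is_series_ext_R. intros k. unfold minus, plus, opp, d; simpl. ring.
    - intros z Hz.
      replace (Finite 0) with (Finite (Rpower (1 + rho * (1 - z)) (- a)
        - Rpower (1 + rho * (1 - z)) (- a))) by (f_equal; ring).
      apply is_lim_seq_minus'; [|apply is_lim_seq_const].
      apply (draws_pgf_lim al be ga w0 b (fun _ => z)); try assumption.
      + exists 0%nat. intros. lra.
      + nra.
      + now apply (is_lim_seq_scal_r _ (1 - z) rho). }
  pose proof (is_lim_seq_plus' _ _ _ _ Hd0 (is_lim_seq_const (mpo_pmf a rho l))) as H.
  rewrite Rplus_0_l in H. eapply is_lim_seq_ext; [|exact H]. intros n. unfold d. simpl. ring.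
Qed.

(** Both distribution functions are finite sums over the integers up to x, so the convergence of
    single masses gives the limit at every x, jumps included. *)
Lemma urn_cdf_cvg_mpo (al be ga w0 : nat) (b : nat -> nat) (rho x : R) :
  (1 <= al)%nat -> (1 <= w0)%nat -> ga = (al + be)%nat ->
  is_lim_seq (fun n => INR (b n)) p_infty -> 0 < rho ->
  is_lim_seq (fun n => lam al ga n (b n)) rho ->
  is_lim_seq (fun n => urn_cdf w0 (b n) al ga n (fun y => y - INR w0 / INR al) x)
    (mpo_cdf (INR w0 / INR al) rho x).
Proof.
  intros Hal Hw Hga Hb Hrho Hl. set (a := INR w0 / INR al).
  destruct (INR_unbounded x) as [N HN].
  set (q := fun l => if Rle_dec (INR l) x then mpo_pmf a rho l else 0).
  set (p := fun n l => urn_law w0 (b n) al ga n l * (if Rle_dec (INR l) x then 1 else 0)).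
  assert (Hgt : forall k, (N < k)%nat -> ~ INR k <= x).
  { intros k Hk. apply lt_INR in Hk. lra. }
  replace (mpo_cdf a rho x) with (sum_f_R0 q N).
  2:{ symmetry. apply is_series_unique, is_series_stationary.
      intros k Hk. unfold q. destruct (Rle_dec (INR k) x); [|reflexivity].
      exfalso. now apply (Hgt k). }
  apply is_lim_seq_ext_loc with (fun n => sum_f_R0 (p n) N).
  - exists N. intros n Hn.
    transitivity (sum_f_R0 (p n) n).
    + symmetry. apply sum_f_R0_stationary; [|exact Hn].
      intros k Hk. unfold p. destruct (Rle_dec (INR k) x); [|ring].
      exfalso. now apply (Hgt k).
    + apply sum_eq. intros k _. unfold p. rewrite Xval_eq by assumption.
      fold a. replace (a + INR k - a) with (INR k) by ring. reflexivity.
  - apply is_lim_seq_sum_f_R0. intros k. unfold p, q.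
    pose proof (urn_law_cvg al be ga w0 b rho k Hal Hw Hga Hb Hrho Hl) as H.
    destruct (Rle_dec (INR k) x) as [Hk|Hk].
    + eapply is_lim_seq_ext; [|exact H]. intros n. simpl. ring.
    + apply is_lim_seq_ext with (fun _ => 0); [|apply is_lim_seq_const]. intros n. ring.
Qed.

(** * Convergence to the Gamma law *)

(** Bernoulli's inequality and its counterpart from above: the power is near 1 if M u is small and
    near 0 if M u is large. *)
Lemma one_minus_pow_bounds (u : R) (M : nat) : 0 <= u <= 1 ->
  1 - INR M * u <= (1 - u) ^ M <= / (1 + INR M * u).
Proof.
  intros Hu. split.
  - induction M as [|M IH]; [simpl; lra|].
    rewrite S_INR. simpl pow. pose proof (pos_INR M).
    apply Rle_trans with ((1 - u) * (1 - INR M * u)); [nra|].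
    apply Rmult_le_compat_l; lra.
  - assert (H : (1 - u) ^ M * (1 + INR M * u) <= 1).
    { induction M as [|M IH]; [simpl; lra|].
      rewrite S_INR. simpl pow. pose proof (pos_INR M).
      assert (0 <= (1 - u) ^ M) by (apply pow_le; lra).
      apply Rle_trans with ((1 - u) ^ M * (1 + INR M * u)); [|exact IH].
      replace ((1 - u) * (1 - u) ^ M * (1 + (INR M + 1) * u))
        with ((1 - u) ^ M * ((1 - u) * (1 + (INR M + 1) * u))) by ring.
      apply Rmult_le_compat_l; [assumption | nra]. }
    assert (0 < 1 + INR M * u) by (pose proof (pos_INR M); nra).
    apply Rmult_le_reg_r with (1 + INR M * u); [assumption|]. rewrite Rinv_l; lra.
Qed.

Lemma exp_le_compat (x y : R) : x <= y -> exp x <= exp y.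
Proof. intros [H | ->]; [left; now apply exp_increasing | right; reflexivity]. Qed.

Lemma exp_ge1 (y : R) : 0 <= y -> 1 <= exp y.
Proof. intros Hy. pose proof (exp_ineq1_le y). lra. Qed.

(* With [M] close to [exp (m (c + c')/2)] the number [M exp (- m x)] is huge for
   [x <= c] and tiny for [x >= c']. *)
Lemma step_approximation (c c' eta : R) : 0 <= c < c' -> 0 < eta < 1 ->
  exists m M, 0 <= m /\ forall x, 0 <= x ->
    0 <= (1 - exp (- m * x)) ^ M <= 1 /\
    (x <= c -> (1 - exp (- m * x)) ^ M <= eta) /\
    (c' <= x -> 1 - eta <= (1 - exp (- m * x)) ^ M).
Proof.
  intros Hc Heta. set (d := (c' - c) / 2). assert (Hd : 0 < d) by (unfold d; lra).
  set (m := ln (2 / eta) / d).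
  assert (Hl : 0 <= ln (2 / eta)).
  { rewrite <- ln_1. apply ln_le; [lra|].
    apply Rmult_le_reg_r with eta; [lra|]. field_simplify; lra. }
  assert (Hm : 0 <= m) by (apply Rdiv_le_0_compat; assumption).
  assert (Emd : exp (m * d) = 2 / eta).
  { replace (m * d) with (ln (2 / eta)) by (unfold m; field; lra).
    apply exp_ln, Rdiv_lt_0_compat; lra. }
  assert (Emd' : exp (- (m * d)) = eta / 2) by (rewrite exp_Ropp, Emd; field; lra).
  set (E := exp (m * (c + d))).
  assert (HE : 1 <= E) by (apply exp_ge1, Rmult_le_pos; lra).
  destruct (nfloor_ex E ltac:(lra)) as [M' [HM1 HM2]].
  exists m, (S M'). split; [exact Hm|]. intros x Hx.
  assert (Hu : 0 <= exp (- m * x) <= 1).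
  { split; [left; apply exp_pos|]. rewrite Ropp_mult_distr_l_reverse.
    apply exp_opp_le1, Rmult_le_pos; assumption. }
  destruct (one_minus_pow_bounds _ (S M') Hu) as [B1 B2].
  rewrite S_INR in B1, B2.
  set (u := exp (- m * x)) in *.
  assert (EuE : E * u = exp (m * (c + d - x)))
    by (unfold E, u; rewrite <- exp_plus; f_equal; ring).
  repeat split.
  - apply pow_le; lra.
  - apply Rle_trans with (1 ^ S M'); [apply pow_incr; lra | rewrite pow1; lra].
  - intros Hxc. eapply Rle_trans; [exact B2|].
    assert (2 / eta <= E * u).
    { rewrite EuE, <- Emd. apply exp_le_compat. apply Rmult_le_compat_l; lra. }
    assert (E * u <= (INR M' + 1) * u) by (apply Rmult_le_compat_r; lra).
    assert (0 < 2 / eta) by (apply Rdiv_lt_0_compat; lra).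
    apply Rle_trans with (/ (2 / eta)); [apply Rinv_le_contravar; lra|].
    rewrite Rinv_div. lra.
  - intros Hxc. eapply Rle_trans; [|exact B1].
    assert (E * u <= eta / 2).
    { rewrite EuE, <- Emd'. rewrite Ropp_mult_distr_r.
      apply exp_le_compat. apply Rmult_le_compat_l; unfold d in *; lra. }
    assert ((INR M' + 1) * u <= 2 * (E * u)) by nra. lra.
Qed.

Lemma is_RInt_gen_gamma_mass (a : R) : 0 < a ->
  is_RInt_gen (gamma_density a) (at_right 0) (Rbar_locally p_infty) 1.
Proof.
  intros Ha. pose proof (is_RInt_gen_gamma_moment a 0 Ha) as H. simpl in H.
  revert H. apply (is_RInt_gen_ext_pos _ _ _ _ _ _ cofinal_in_p_infty).
  intros x _. ring.
Qed.

Lemma RInt_gamma_density_le1 (a x y : R) : 0 < a -> 0 < x -> x <= y ->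
  RInt (gamma_density a) x y <= 1.
Proof.
  intros Ha Hx Hxy.
  apply RInt_le_gen with (Rbar_locally p_infty) (fun y => 0 < y); try lra.
  - apply Rbar_locally_filter.
  - intros; now apply continuous_gamma_density.
  - intros; left; now apply gamma_density_pos.
  - apply cofinal_in_p_infty.
  - now apply is_RInt_gen_gamma_mass.
Qed.

Lemma is_RInt_gen_gamma_cdf (a c : R) : 0 < a -> 0 < c ->
  is_RInt_gen (gamma_density a) (at_right 0) (at_point c) (gamma_cdf a c).
Proof.
  intros Ha Hc. unfold gamma_cdf. destruct (Rle_dec c 0) as [|_]; [lra|].
  apply (@RInt_gen_correct R_CompleteNormedModule); try typeclasses eauto.
  apply ex_RInt_gen_bounded with (D := fun y => y = c) (M := 1).
  - typeclasses eauto.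
  - intros; now apply continuous_gamma_density.
  - intros; left; now apply gamma_density_pos.
  - now apply cofinal_in_point.
  - intros x y Hx Hxy _. now apply RInt_gamma_density_le1.
Qed.

Lemma RInt_le_gamma_cdf (a x c : R) : 0 < a -> 0 < x -> x <= c ->
  RInt (gamma_density a) x c <= gamma_cdf a c.
Proof.
  intros Ha Hx Hxc.
  apply RInt_le_gen with (at_point c) (fun y => y = c); try lra.
  - typeclasses eauto.
  - intros; now apply continuous_gamma_density.
  - intros; left; now apply gamma_density_pos.
  - apply cofinal_in_point; lra.
  - apply is_RInt_gen_gamma_cdf; lra.
Qed.

Lemma gamma_cdf_le (a c M : R) : 0 < a -> 0 <= M ->
  (forall x, 0 < x <= c -> RInt (gamma_density a) x c <= M) -> gamma_cdf a c <= M.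
Proof.
  intros Ha HM H. destruct (Rle_lt_dec c 0) as [Hc|Hc].
  - unfold gamma_cdf. destruct (Rle_dec c 0); lra.
  - apply (is_RInt_gen_upper (gamma_density a) (at_point c) (fun y => y = c))
      with (3 := is_RInt_gen_gamma_cdf a c Ha Hc).
    + typeclasses eauto.
    + now apply cofinal_in_point.
    + intros x y Hx Hxy ->. apply H. lra.
Qed.

Lemma continuous_mult_gamma (a : R) (phi : R -> R) : 0 < a ->
  (forall z, continuous phi z) ->
  forall z, 0 < z -> continuous (fun x => phi x * gamma_density a x) z.
Proof.
  intros Ha Hphi z Hz. apply (continuous_mult phi (gamma_density a)); [apply Hphi|].
  now apply continuous_gamma_density.
Qed.

(** The number 1 - v is the Gamma integral of 1 - phi, a smoothed indicator of [0, c]: it is at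
    least 1 - eta up to c and at most eta from c' on. *)
Lemma gamma_cdf_squeeze (a c c' eta v : R) (phi : R -> R) :
  0 < a -> 0 <= c < c' -> 0 < eta ->
  (forall z, continuous phi z) ->
  (forall x, 0 <= x -> 0 <= phi x <= 1) ->
  (forall x, 0 <= x <= c -> phi x <= eta) ->
  (forall x, c' <= x -> 1 - eta <= phi x) ->
  is_RInt_gen (fun x => phi x * gamma_density a x) (at_right 0) (Rbar_locally p_infty) v ->
  gamma_cdf a c - eta <= 1 - v <= gamma_cdf a c' + eta.
Proof.
  intros Ha Hc Heta Hcont H01 Hlow Hhigh Hv.
  pose proof (is_RInt_gen_minus _ _ _ _ (is_RInt_gen_gamma_mass a Ha) Hv) as Hw.
  set (w := 1 - v). change (minus 1 v) with w in Hw.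
  set (psi := fun x => (1 - phi x) * gamma_density a x).
  apply (is_RInt_gen_ext_pos _ psi _ _ _ _ cofinal_in_p_infty) in Hw.
  2:{ intros x _. unfold minus, plus, opp, psi; simpl. ring. }
  assert (Hcd : forall z, 0 < z -> continuous (gamma_density a) z)
    by (intros; now apply continuous_gamma_density).
  assert (Hcpsi : forall z, 0 < z -> continuous psi z).
  { apply continuous_mult_gamma; [exact Ha|]. intros z.
    apply (continuous_minus (fun _ => 1) phi); [apply continuous_const | apply Hcont]. }
  assert (Hd0 : forall z, 0 < gamma_density a z) by (intros; now apply gamma_density_pos).
  assert (Hpsi0 : forall z, 0 < z -> 0 <= psi z).
  { intros z Hz. apply Rmult_le_pos; [specialize (H01 z ltac:(lra)); lra | left; apply Hd0]. }
  assert (Ex : forall f x y, (forall z, 0 < z -> continuous f z) -> 0 < x -> x <= y ->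
                 ex_RInt f x y) by (intros; now apply ex_RInt_pos_cont).
  split.
  - apply Rle_trans with ((1 - eta) * gamma_cdf a c).
    { assert (gamma_cdf a c <= 1).
      { apply gamma_cdf_le; [exact Ha | lra|]. intros. apply RInt_gamma_density_le1; lra. }
      nra. }
    assert (Hw0 : 0 <= w).
    { apply Rle_trans with (RInt psi 1 1); [rewrite RInt_point; apply Rle_refl|].
      apply RInt_le_gen with (Rbar_locally p_infty) (fun y => 0 < y); try lra; try assumption.
      - apply Rbar_locally_filter.
      - apply cofinal_in_p_infty. }
    (* For eta >= 1 the left side is non-positive; otherwise 1 - eta can be moved to the other side
       as a divisor. *)
    destruct (Rle_lt_dec 1 eta) as [He|He].
    { assert (0 <= gamma_cdf a c).
      { destruct (Rle_lt_dec c 0) as [Hc0|Hc0].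
        - unfold gamma_cdf. destruct (Rle_dec c 0); lra.
        - apply Rle_trans with (RInt (gamma_density a) c c);
            [rewrite RInt_point; apply Rle_refl | apply RInt_le_gamma_cdf; lra]. }
      nra. }
    apply Rmult_le_reg_l with (/ (1 - eta)); [apply Rinv_0_lt_compat; lra|].
    rewrite <- Rmult_assoc, Rinv_l, Rmult_1_l by lra.
    apply gamma_cdf_le; [exact Ha | apply Rmult_le_pos; [left; apply Rinv_0_lt_compat; lra | exact Hw0] |].
    intros x Hx. apply Rmult_le_reg_l with (1 - eta); [lra|].
    rewrite <- Rmult_assoc, Rinv_r, Rmult_1_l by lra.
    apply Rle_trans with (RInt psi x c).
    + apply (is_RInt_le (fun t => (1 - eta) * gamma_density a t) psi x c); [lra | | |].
      * apply (is_RInt_scal (gamma_density a) x c (1 - eta)).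
        apply (@RInt_correct R_CompleteNormedModule), Ex; auto; lra.
      * apply (@RInt_correct R_CompleteNormedModule), Ex; auto; lra.
      * intros t Ht. apply Rmult_le_compat_r; [left; apply Hd0|].
        specialize (Hlow t ltac:(lra)). lra.
    + apply RInt_le_gen with (Rbar_locally p_infty) (fun y => 0 < y); try lra; try assumption.
      * apply Rbar_locally_filter.
      * apply cofinal_in_p_infty.
  - apply (is_RInt_gen_upper psi (Rbar_locally p_infty) (fun y => 0 < y)) with (3 := Hw).
    + apply Rbar_locally_filter.
    + apply cofinal_in_p_infty.
    + intros x y Hx Hxy _.
      (* The interval is enlarged to contain c', where the integral is split. *)
      set (x' := Rmin x c'). set (y' := Rmax y c').
      pose proof (Rmin_l x c'). pose proof (Rmin_r x c').
      pose proof (Rmax_l y c'). pose proof (Rmax_r y c').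
      assert (Hx' : 0 < x') by (apply Rmin_glb_lt; lra).
      apply Rle_trans with (RInt psi x' y').
      { apply RInt_subinterval; try assumption. }
      rewrite <- (RInt_Chasles psi x' c' y') by (apply Ex; auto; lra).
      apply Rplus_le_compat.
      * eapply Rle_trans; [|apply (RInt_le_gamma_cdf a x' c'); assumption].
        apply RInt_le; [assumption | apply Ex; auto | apply Ex; auto |].
        intros t Ht. unfold psi. specialize (H01 t ltac:(lra)).
        specialize (Hd0 t). nra.
      * apply Rle_trans with (eta * RInt (gamma_density a) c' y').
        -- apply (is_RInt_le psi (fun t => eta * gamma_density a t) c' y'); [assumption | | |].
           ++ apply (@RInt_correct R_CompleteNormedModule), Ex; auto; lra.
           ++ apply (is_RInt_scal (gamma_density a) c' y' eta).
              apply (@RInt_correct R_CompleteNormedModule), Ex; auto; lra.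
           ++ intros t Ht. apply Rmult_le_compat_r; [left; apply Hd0|].
              specialize (Hhigh t ltac:(lra)). lra.
        -- pose proof (RInt_gamma_density_le1 a c' y' Ha ltac:(lra) ltac:(assumption)). nra.
Qed.

(** The Laplace transform is the generating function at z_n = exp (- m / lam), and lam (1 - z_n)
    lies between m - m^2 / lam and m. *)
Lemma draws_laplace_lim (al be ga w0 : nat) (b : nat -> nat) (m : R) :
  (1 <= al)%nat -> (1 <= w0)%nat -> ga = (al + be)%nat ->
  is_lim_seq (fun n => INR (b n)) p_infty ->
  is_lim_seq (fun n => lam al ga n (b n)) p_infty -> 0 <= m ->
  is_lim_seq (fun n => draws_expect w0 (b n) al ga n
                (fun k => exp (- m * (INR k / lam al ga n (b n)))))
    (Rpower (1 + m) (- (INR w0 / INR al))).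
Proof.
  intros Hal Hw Hga Hb Hl Hm.
  set (z := fun n => exp (- (m / lam al ga n (b n)))).
  apply is_lim_seq_ext with (fun n => draws_expect w0 (b n) al ga n (fun k => z n ^ k)).
  { intros n. apply draws_expect_ext. intros k. unfold z.
    rewrite <- Rpower_pow by apply exp_pos. unfold Rpower. rewrite ln_exp. f_equal.
    unfold Rdiv. ring. }
  assert (Hpos : eventually (fun n => 0 < lam al ga n (b n))).
  { apply is_lim_seq_spec in Hl. destruct (Hl 0) as [N HN]. now exists N. }
  apply (draws_pgf_lim al be ga w0 b z m); try assumption.
  - destruct Hpos as [N HN]. exists N. intros n Hn. unfold z. split; [left; apply exp_pos|].
    apply exp_opp_le1, Rdiv_le_0_compat; auto.
  - apply is_lim_seq_le_le_loc with (u := fun n => m - m ^ 2 * / lam al ga n (b n)) (w := fun _ => m).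
    + destruct Hpos as [N HN]. exists N. intros n Hn. specialize (HN n Hn). unfold z.
      set (L := lam al ga n (b n)) in *. set (h := m / L).
      assert (Hh : 0 <= h) by (apply Rdiv_le_0_compat; assumption).
      assert (Em : m = L * h) by (unfold h; field; lra).
      pose proof (exp_ineq1_le (- h)) as E1.
      pose proof (exp_opp_le_quadratic h Hh) as E2.
      split.
      * replace (m - m ^ 2 * / L) with (L * (h - h ^ 2)) by (rewrite Em; field; lra).
        apply Rmult_le_compat_l; lra.
      * rewrite Em. apply Rmult_le_compat_l; lra.
    + replace (Finite m) with (Finite (m - m ^ 2 * 0)) by (f_equal; ring).
      apply is_lim_seq_minus'; [apply is_lim_seq_const|].
      apply (is_lim_seq_scal_l _ (m ^ 2) 0).
      replace (Finite 0) with (Rbar_inv p_infty) by reflexivity.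
      apply is_lim_seq_inv; [exact Hl | discriminate].
    + apply is_lim_seq_const.
Qed.

(** The prefactor exp (- i x) makes the induction on j work without a binomial expansion: one more
    factor 1 - exp (- m x) is the difference of the cases i and i + m. The shared [v] ties the limit
    to the Gamma integral. *)
Lemma draws_laplace_poly_lim (al be ga w0 : nat) (b : nat -> nat) (m i : R) (j : nat) :
  (1 <= al)%nat -> (1 <= w0)%nat -> ga = (al + be)%nat ->
  is_lim_seq (fun n => INR (b n)) p_infty ->
  is_lim_seq (fun n => lam al ga n (b n)) p_infty -> 0 <= m -> 0 <= i ->
  let phi := fun x => exp (- i * x) * (1 - exp (- m * x)) ^ j in
  exists v, is_RInt_gen (fun x => phi x * gamma_density (INR w0 / INR al) x)
              (at_right 0) (Rbar_locally p_infty) v /\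
    is_lim_seq (fun n => draws_expect w0 (b n) al ga n
                  (fun k => phi (INR k / lam al ga n (b n)))) v.
Proof.
  intros Hal Hw Hga Hb Hl Hm. pose proof (white_share_pos w0 al Hal Hw) as Ha.
  revert i. induction j as [|j IH]; intros i Hi; simpl.
  - exists (Rpower (1 + i) (- (INR w0 / INR al))). split.
    + pose proof (is_RInt_gen_gamma_laplace (INR w0 / INR al) i 0 Ha Hi) as H.
      simpl in H. rewrite Rplus_0_r, Rmult_1_l in H.
      revert H. apply (is_RInt_gen_ext_pos _ _ _ _ _ _ cofinal_in_p_infty). intros x _. ring.
    + eapply is_lim_seq_ext; [|exact (draws_laplace_lim al be ga w0 b i Hal Hw Hga Hb Hl Hi)].
      intros n. apply draws_expect_ext. intros k. simpl. ring.
  - destruct (IH i Hi) as [v1 [I1 L1]]. destruct (IH (i + m) ltac:(lra)) as [v2 [I2 L2]].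
    assert (E : forall x, exp (- (i + m) * x) = exp (- i * x) * exp (- m * x))
      by (intros; rewrite <- exp_plus; f_equal; ring).
    exists (v1 - v2). split.
    + pose proof (is_RInt_gen_minus _ _ _ _ I1 I2) as H.
      revert H. apply (is_RInt_gen_ext_pos _ _ _ _ _ _ cofinal_in_p_infty).
      intros x _. unfold minus, plus, opp; simpl. rewrite E. ring.
    + eapply is_lim_seq_ext; [|exact (is_lim_seq_minus' _ _ _ _ L1 L2)].
      intros n. simpl.
      transitivity (1 * draws_expect w0 (b n) al ga n (fun k =>
          exp (- i * (INR k / lam al ga n (b n))) * (1 - exp (- m * (INR k / lam al ga n (b n)))) ^ j)
        + (-1) * draws_expect w0 (b n) al ga n (fun k =>
          exp (- (i + m) * (INR k / lam al ga n (b n)))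
          * (1 - exp (- m * (INR k / lam al ga n (b n)))) ^ j)); [ring|].
      rewrite <- draws_expect_lin. apply draws_expect_ext. intros k. rewrite E. ring.
Qed.

(** * Squeezing the distribution functions *)

Definition scaled_cdf (w0 al ga : nat) (b : nat -> nat) (n : nat) (x : R) : R :=
  draws_expect w0 (b n) al ga n
    (fun k => if Rle_dec (INR k / lam al ga n (b n)) x then 1 else 0).

Lemma scaled_cdf_bounds (w0 al ga : nat) (b : nat -> nat) (n : nat) (x : R) :
  (1 <= w0)%nat -> (al <= ga)%nat -> 0 <= scaled_cdf w0 al ga b n x <= 1.
Proof.
  intros Hw Hag. unfold scaled_cdf. split.
  - apply Rle_trans with (draws_expect w0 (b n) al ga n (fun _ => 0));
      [rewrite draws_expect_const; lra|].
    apply draws_expect_le; try assumption. intros k. destruct (Rle_dec _ _); lra.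
  - apply Rle_trans with (draws_expect w0 (b n) al ga n (fun _ => 1));
      [|rewrite draws_expect_const; lra].
    apply draws_expect_le; try assumption. intros k. destruct (Rle_dec _ _); lra.
Qed.

(** One test function phi separates c from c' on both sides. Of the three eta, one is the step error
    under the urn law, one the step error under the Gamma law, and one the distance of the
    expectation of phi from its limit. *)
Lemma scaled_cdf_squeeze (al be ga w0 : nat) (b : nat -> nat) (c c' eta : R) :
  (1 <= al)%nat -> (1 <= w0)%nat -> ga = (al + be)%nat ->
  is_lim_seq (fun n => INR (b n)) p_infty ->
  is_lim_seq (fun n => lam al ga n (b n)) p_infty ->
  0 <= c < c' -> 0 < eta < 1 ->
  eventually (fun n => scaled_cdf w0 al ga b n c <= gamma_cdf (INR w0 / INR al) c' + 3 * eta) /\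
  eventually (fun n => gamma_cdf (INR w0 / INR al) c - 3 * eta <= scaled_cdf w0 al ga b n c').
Proof.
  intros Hal Hw Hga Hb Hl Hc Heta. pose proof (white_share_pos w0 al Hal Hw) as Ha.
  destruct (step_approximation c c' eta Hc Heta) as (m & M & Hm & Hphi).
  destruct (draws_laplace_poly_lim al be ga w0 b m 0 M Hal Hw Hga Hb Hl Hm (Rle_refl 0))
    as (v & Iv & Lv).
  set (phi := fun x => (1 - exp (- m * x)) ^ M).
  assert (E0 : forall x, exp (- 0 * x) * (1 - exp (- m * x)) ^ M = phi x).
  { intros x. replace (- 0 * x) with 0 by ring. rewrite exp_0. unfold phi. ring. }
  assert (Iv' : is_RInt_gen (fun x => phi x * gamma_density (INR w0 / INR al) x)
                  (at_right 0) (Rbar_locally p_infty) v).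
  { revert Iv. apply (is_RInt_gen_ext_pos _ _ _ _ _ _ cofinal_in_p_infty).
    intros x _. now rewrite E0. }
  destruct (gamma_cdf_squeeze (INR w0 / INR al) c c' eta v phi Ha Hc (proj1 Heta)) as [S1 S2].
  - intros z. apply (ex_derive_continuous phi). unfold phi. auto_derive. trivial.
  - intros x Hx. apply (Hphi x Hx).
  - intros x Hx. apply (Hphi x (proj1 Hx)). lra.
  - intros x Hx. apply (Hphi x ltac:(lra)). lra.
  - exact Iv'.
  - apply is_lim_seq_spec in Lv.
    destruct (Lv (mkposreal eta (proj1 Heta))) as [N1 HN1].
    pose proof Hl as Hl'. apply is_lim_seq_spec in Hl'. destruct (Hl' 0) as [N2 HN2].
    assert (Hag : (al <= ga)%nat) by lia.
    assert (Key : forall n, (Nat.max N1 N2 <= n)%nat ->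
       scaled_cdf w0 al ga b n c - eta <= 1 - v + eta /\
       1 - v - eta <= scaled_cdf w0 al ga b n c' + eta).
    { intros n Hn. specialize (HN1 n ltac:(lia)). specialize (HN2 n ltac:(lia)). simpl in HN1.
      rewrite (draws_expect_ext _ _ _ _ _ _ _ (fun k => E0 _)) in HN1.
      apply Rabs_def2 in HN1. set (L := lam al ga n (b n)) in *.
      assert (HX : forall k, 0 <= INR k / L)
        by (intros k; apply Rdiv_le_0_compat; [apply pos_INR | exact HN2]).
      assert (B1 : 1 * draws_expect w0 (b n) al ga n (fun k => phi (INR k / L))
                   + 1 * scaled_cdf w0 al ga b n c <= 1 + eta).
      { unfold scaled_cdf. fold L. rewrite <- draws_expect_lin.
        rewrite <- (draws_expect_const w0 (b n) al ga n (1 + eta)).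
        apply draws_expect_le; try assumption. intros k.
        destruct (Hphi (INR k / L) (HX k)) as (P1 & P2 & _). unfold phi.
        destruct (Rle_dec (INR k / L) c) as [Hk|Hk]; [specialize (P2 Hk)|]; lra. }
      assert (B2 : 1 - eta <= 1 * draws_expect w0 (b n) al ga n (fun k => phi (INR k / L))
                   + 1 * scaled_cdf w0 al ga b n c').
      { unfold scaled_cdf. fold L. rewrite <- draws_expect_lin.
        rewrite <- (draws_expect_const w0 (b n) al ga n (1 - eta)).
        apply draws_expect_le; try assumption. intros k.
        destruct (Hphi (INR k / L) (HX k)) as (P1 & _ & P3). unfold phi.
        destruct (Rle_dec (INR k / L) c') as [Hk|Hk]; [lra|].
        specialize (P3 ltac:(lra)). lra. }
      lra. }
    split; exists (Nat.max N1 N2); intros n Hn; destruct (Key n Hn); lra.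
Qed.

Lemma scaled_cdf_cvg (al be ga w0 : nat) (b : nat -> nat) :
  (1 <= al)%nat -> (1 <= w0)%nat -> ga = (al + be)%nat ->
  is_lim_seq (fun n => INR (b n)) p_infty ->
  is_lim_seq (fun n => lam al ga n (b n)) p_infty ->
  conv_in_dist (scaled_cdf w0 al ga b) (gamma_cdf (INR w0 / INR al)).
Proof.
  intros Hal Hw Hga Hb Hl x Hx. set (F := gamma_cdf (INR w0 / INR al)) in *.
  assert (HF0 : forall y, y <= 0 -> F y = 0).
  { intros y Hy. unfold F, gamma_cdf. destruct (Rle_dec y 0); lra. }
  apply is_lim_seq_spec. intros eps. pose proof (cond_pos eps) as He.
  (* The bound 1/2 keeps eta below 1, and 3 eta < eps / 2 leaves eps / 2 for the continuity of F at
     x. *)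
  set (eta := Rmin (/ 2) (eps / 8)).
  assert (Heta : 0 < eta < 1).
  { unfold eta. pose proof (Rmin_l (/ 2) (eps / 8)).
    split; [apply Rmin_glb_lt; lra | lra]. }
  assert (Heta' : eta <= eps / 8) by apply Rmin_r.
  assert (He2 : 0 < eps / 2) by lra.
  pose proof (proj1 (continuity_pt_locally F x) Hx (mkposreal _ He2)) as [d Hd].
  simpl in Hd. pose proof (cond_pos d) as Hd0.
  assert (Hnear : forall y, Rabs (y - x) < d -> Rabs (F y - F x) < eps / 2)
    by (intros y Hy; apply Hd, Hy).
  assert (Up : eventually (fun n => scaled_cdf w0 al ga b n x < F x + eps)).
  (* The squeeze works on [0, oo) only; for x < 0 both distribution functions are 0. *)
  { destruct (Rlt_le_dec x 0) as [Hx0|Hx0].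
    - apply is_lim_seq_spec in Hl. destruct (Hl 0) as [N HN]. exists N. intros n Hn.
      rewrite HF0 by lra. unfold scaled_cdf.
      rewrite (draws_expect_ext _ _ _ _ _ _ (fun _ => 0)).
      + rewrite draws_expect_const. lra.
      + intros k. specialize (HN n Hn).
        assert (0 <= INR k / lam al ga n (b n))
          by (apply Rdiv_le_0_compat; [apply pos_INR | exact HN]).
        destruct (Rle_dec _ _); lra.
    - destruct (scaled_cdf_squeeze al be ga w0 b x (x + d / 2) eta Hal Hw Hga Hb Hl
        ltac:(lra) Heta) as [[N HN] _].
      exists N. intros n Hn. specialize (HN n Hn). fold F in HN.
      assert (HH : Rabs (x + d / 2 - x) < d) by (rewrite Rabs_pos_eq; lra).
      apply Hnear, Rabs_def2 in HH. lra. }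
  assert (Lo : eventually (fun n => F x - eps < scaled_cdf w0 al ga b n x)).
  { destruct (Rle_lt_dec x 0) as [Hx0|Hx0].
    - exists 0%nat. intros n _. rewrite HF0 by assumption.
      pose proof (scaled_cdf_bounds w0 al ga b n x Hw ltac:(lia)). lra.
    (* Cut off at 0, because the squeeze asks for c >= 0. *)
    - set (c := Rmax 0 (x - d / 2)).
      assert (Hc : 0 <= c < x) by (split; [apply Rmax_l | apply Rmax_lub_lt; lra]).
      pose proof (Rmax_r 0 (x - d / 2) : _ <= c) as Hc2.
      destruct (scaled_cdf_squeeze al be ga w0 b c x eta Hal Hw Hga Hb Hl Hc Heta) as [_ [N HN]].
      exists N. intros n Hn. specialize (HN n Hn). fold F in HN.
      assert (HH : Rabs (c - x) < d) by (apply Rabs_def1; lra).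
      apply Hnear, Rabs_def2 in HH. lra. }
  destruct Up as [N1 H1]. destruct Lo as [N2 H2].
  exists (Nat.max N1 N2). intros n Hn.
  specialize (H1 n ltac:(lia)). specialize (H2 n ltac:(lia)). apply Rabs_def1; lra.
Qed.

(** * The limit theorems *)

Lemma urn_expect_rising (w0 b0 al ga n s : nat) :
  (1 <= al)%nat -> (1 <= w0)%nat -> (1 <= ga)%nat ->
  urn_expect w0 b0 al ga n (fun x => rising x s) =
    Gamma (INR n + (INR w0 + INR b0 + INR s * INR al) / INR ga)
    * Gamma ((INR w0 + INR b0) / INR ga)
    * Gamma (INR w0 / INR al + INR s)
    / (Gamma ((INR w0 + INR b0 + INR s * INR al) / INR ga)
       * Gamma (INR n + (INR w0 + INR b0) / INR ga)
       * Gamma (INR w0 / INR al)).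
Proof.
  intros Hal Hw Hg. pose proof (white_share_pos w0 al Hal Hw) as Ha.
  assert (Hg0 : 0 < INR ga) by (apply lt_0_INR; lia).
  assert (Hw0 : 0 < INR w0) by (apply lt_0_INR; lia).
  assert (Hal0 : 0 < INR al) by (apply lt_0_INR; lia).
  pose proof (pos_INR b0). pose proof (pos_INR s).
  assert (Hsa : 0 <= INR s * INR al) by (apply Rmult_le_pos; lra).
  set (x := (INR w0 + INR b0 + INR s * INR al) / INR ga).
  set (y := (INR w0 + INR b0) / INR ga).
  assert (Hx : 0 < x) by (apply Rdiv_lt_0_compat; lra).
  assert (Hy : 0 < y) by (apply Rdiv_lt_0_compat; lra).
  pose proof (Gamma_pos x Hx). pose proof (Gamma_pos y Hy).
  pose proof (Gamma_pos _ Ha). rewrite Gamma_rising by exact Ha.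
  change (urn_expect w0 b0 al ga n (fun x => rising x s))
    with (draws_expect w0 b0 al ga n (fun k => rising (Xval w0 al k) s)).
  induction n as [|n IH].
  - rewrite draws_expect_0, Xval_eq by assumption. simpl (INR 0).
    rewrite !Rplus_0_r, !Rplus_0_l. field. lra.
  - rewrite draws_expect_rising_S, IH by assumption.
    pose proof (pos_INR n).
    pose proof (Gamma_pos (INR n + x) ltac:(lra)). pose proof (Gamma_pos (INR n + y) ltac:(lra)).
    replace (INR (S n) + x) with (INR n + x + 1) by (rewrite S_INR; ring).
    replace (INR (S n) + y) with (INR n + y + 1) by (rewrite S_INR; ring).
    rewrite !Gamma_S by lra.
    pose proof (urn_total_pos w0 b0 ga n Hw) as HT.
    assert (Ey : INR n + y = urn_total w0 b0 ga n / INR ga)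
      by (unfold y, urn_total; field; lra).
    (* This is the factor that Gamma (z + 1) = z Gamma (z) brings into the quotient. *)
    assert (E : 1 + INR s * white_rate w0 b0 al ga n = (INR n + x) / (INR n + y)).
    { rewrite Ey. unfold x, white_rate, urn_total in *. field. lra. }
    rewrite E. field. repeat split; lra.
Qed.

Lemma urn_expect_falling_asymp (al be ga w0 : nat) (b : nat -> nat) (s : nat) :
  (1 <= al)%nat -> (1 <= w0)%nat -> ga = (al + be)%nat ->
  is_lim_seq (fun n => INR (b n)) p_infty ->
  let a := INR w0 / INR al in
  exists eps : nat -> R, is_lim_seq eps 0 /\
    exists N : nat, forall n : nat, (N <= n)%nat ->
      urn_expect w0 (b n) al ga n (fun x => falling (x - a) s) =
        lam al ga n (b n) ^ s * (Gamma (a + INR s) / Gamma a) * (1 + eps n).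
Proof.
  intros Hal Hw Hga Hb a. pose proof (white_share_pos w0 al Hal Hw) as Ha.
  exists (fun n => draws_fact w0 (b n) al ga n s / lam al ga n (b n) ^ s - 1). split.
  - replace (Finite 0) with (Finite (1 - 1)) by (f_equal; ring).
    apply is_lim_seq_minus'; [now apply fact_lam_ratio with be | apply is_lim_seq_const].
  - destruct (is_lim_seq_INR_large b 0 Hb) as [N HN].
    exists (Nat.max 1 N). intros n Hn. specialize (HN n ltac:(lia)).
    pose proof (lam_pos al be ga (b n) n Hal Hga ltac:(lia) ltac:(lia)) as Hl.
    unfold a. rewrite draws_expect_falling by assumption. rewrite Gamma_rising by exact Ha.
    pose proof (Gamma_pos _ Ha). field. split; [|lra]. apply pow_nonzero. lra.
Qed.

Lemma draws_expect_sum (w0 b0 al ga n N : nat) (c : nat -> R) (f : nat -> nat -> R) :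
  draws_expect w0 b0 al ga n (fun k => sum_f_R0 (fun j => c j * f j k) N) =
  sum_f_R0 (fun j => c j * draws_expect w0 b0 al ga n (f j)) N.
Proof.
  induction N as [|N IH]; simpl; [apply draws_expect_scal|].
  rewrite <- IH, <- (Rmult_1_l (draws_expect _ _ _ _ _ (fun k => sum_f_R0 _ N))).
  rewrite <- draws_expect_lin. apply draws_expect_ext. intros k. ring.
Qed.

Lemma draws_expect_pow (w0 b0 al ga n s : nat) : (1 <= al)%nat -> (1 <= w0)%nat ->
  draws_expect w0 b0 al ga n (fun k => INR k ^ s) =
  sum_f_R0 (fun j => stirling2 s j *
    (draws_fact w0 b0 al ga n j * rising (INR w0 / INR al) j)) s.
Proof.
  intros Hal Hw.
  rewrite (draws_expect_ext _ _ _ _ _ _ _ (fun k => pow_falling (INR k) s)), draws_expect_sum.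
  apply sum_eq. intros j _. f_equal.
  pose proof (rising_pos _ j (white_share_pos w0 al Hal Hw)).
  unfold draws_fact. field. lra.
Qed.

(** In the expansion of k^s into falling factorials, the order j is of size lam^j, so after division
    by lam^s only j = s survives. *)
Lemma draws_moment_scaled_lim (al be ga w0 : nat) (b : nat -> nat) (s : nat) :
  (1 <= al)%nat -> (1 <= w0)%nat -> ga = (al + be)%nat ->
  is_lim_seq (fun n => INR (b n)) p_infty ->
  is_lim_seq (fun n => lam al ga n (b n)) p_infty ->
  is_lim_seq (fun n => draws_expect w0 (b n) al ga n
    (fun k => (INR k / lam al ga n (b n)) ^ s)) (rising (INR w0 / INR al) s).
Proof.
  intros Hal Hw Hga Hb Hl. set (a := INR w0 / INR al).
  assert (Hinv : is_lim_seq (fun n => / lam al ga n (b n)) 0).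
  { replace (Finite 0) with (Rbar_inv p_infty) by reflexivity.
    apply is_lim_seq_inv; [exact Hl | discriminate]. }
  (* The power 0 ^ (s - j) is 1 for j = s and 0 below; it is the limit of (/ lam) ^ (s - j). *)
  replace (rising a s) with (sum_f_R0 (fun j => stirling2 s j * (1 * 0 ^ (s - j) * rising a j)) s).
  2:{ destruct s as [|s]; [simpl; ring|].
      rewrite tech5, stirling2_diag, Nat.sub_diag, sum_eq_R0; [simpl; ring|].
      intros j Hj. rewrite pow_i by lia. ring. }
  apply is_lim_seq_ext_loc with (fun n => sum_f_R0 (fun j => stirling2 s j *
    (draws_fact w0 (b n) al ga n j / lam al ga n (b n) ^ j * (/ lam al ga n (b n)) ^ (s - j)
     * rising a j)) s).
  - apply is_lim_seq_spec in Hl. destruct (Hl 0) as [N HN]. exists N. intros n Hn.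
    specialize (HN n Hn). set (L := lam al ga n (b n)) in *.
    rewrite (draws_expect_ext _ _ _ _ _ _ (fun k => (/ L) ^ s * INR k ^ s)).
    2:{ intros k. rewrite <- Rpow_mult_distr. f_equal. unfold Rdiv. ring. }
    rewrite draws_expect_scal, draws_expect_pow, scal_sum by assumption.
    apply sum_eq. intros j Hj.
    replace ((/ L) ^ s) with ((/ L) ^ j * (/ L) ^ (s - j))
      by (rewrite <- pow_add; f_equal; lia).
    rewrite (pow_inv L j). unfold a, Rdiv. ring.
  - apply is_lim_seq_sum_f_R0. intros j.
    apply (is_lim_seq_scal_l _ (stirling2 s j) (1 * 0 ^ (s - j) * rising a j)).
    apply (is_lim_seq_scal_r _ (rising a j) (1 * 0 ^ (s - j))).
    apply is_lim_seq_mult'; [now apply fact_lam_ratio with be | now apply is_lim_seq_pow].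
Qed.

Lemma draws_moment_lim (al be ga w0 : nat) (b : nat -> nat) (rho : R) (s : nat) :
  (1 <= al)%nat -> (1 <= w0)%nat -> ga = (al + be)%nat ->
  is_lim_seq (fun n => INR (b n)) p_infty -> 0 < rho ->
  is_lim_seq (fun n => lam al ga n (b n)) rho ->
  is_lim_seq (fun n => draws_expect w0 (b n) al ga n (fun k => INR k ^ s))
    (sum_f_R0 (fun j => stirling2 s j * (rho ^ j * rising (INR w0 / INR al) j)) s).
Proof.
  intros Hal Hw Hga Hb Hrho Hl. set (a := INR w0 / INR al).
  apply is_lim_seq_ext_loc with (fun n => sum_f_R0 (fun j => stirling2 s j *
    (draws_fact w0 (b n) al ga n j / lam al ga n (b n) ^ j * lam al ga n (b n) ^ j
     * rising a j)) s).
  - pose proof Hl as Hl'. apply is_lim_seq_spec in Hl'.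
    destruct (Hl' (mkposreal rho Hrho)) as [N HN].
    exists N. intros n Hn. specialize (HN n Hn). simpl in HN. apply Rabs_def2 in HN.
    rewrite draws_expect_pow by assumption. apply sum_eq. intros j _. fold a.
    field. apply pow_nonzero. lra.
  - apply is_lim_seq_sum_f_R0. intros j.
    apply (is_lim_seq_scal_l _ (stirling2 s j) (rho ^ j * rising a j)).
    apply (is_lim_seq_scal_r _ (rising a j) (rho ^ j)).
    rewrite <- (Rmult_1_l (rho ^ j)).
    apply is_lim_seq_mult'; [now apply fact_lam_ratio with be | now apply is_lim_seq_pow].
Qed.

(** The sum is kept in Stirling form so as to coincide with the limit in [draws_moment_lim]. *)
Lemma mpo_moment (a rho : R) (s : nat) : 0 < a -> 0 < rho ->
  is_series (fun l => INR l ^ s * mpo_pmf a rho l)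
    (sum_f_R0 (fun j => stirling2 s j * (rho ^ j * rising a j)) s).
Proof.
  intros Ha Hrho.
  assert (H : forall N, is_series (fun l => sum_f_R0 (fun j =>
      stirling2 s j * (falling (INR l) j * mpo_pmf a rho l)) N)
    (sum_f_R0 (fun j => stirling2 s j * (rho ^ j * rising a j)) N)).
  { assert (Hj : forall j, is_series (fun l => stirling2 s j * (falling (INR l) j * mpo_pmf a rho l))
        (stirling2 s j * (rho ^ j * rising a j))).
    { intros j. exact (is_series_scal (stirling2 s j) _ _ (mpo_factorial_moment a rho j Ha Hrho)). }
    induction N as [|N IH]; [apply Hj|].
    exact (is_series_plus _ _ _ _ IH (Hj (S N))). }
  specialize (H s). revert H. apply is_series_ext_R. intros l.
  rewrite (pow_falling (INR l) s), (Rmult_comm _ (mpo_pmf a rho l)), scal_sum.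
  apply sum_eq. intros; ring.
Qed.

Theorem theorem2 (al be ga w0 : nat) (Hal : (1 <= al)%nat) (Hw0 : (1 <= w0)%nat)
  (Hga : ga = (al + be)%nat) :
  (* exact rising-factorial moments *)
  (forall (b0 n s : nat), (1 <= s)%nat ->
     urn_expect w0 b0 al ga n (fun x => rising x s) =
       Gamma (INR n + (INR w0 + INR b0 + INR s * INR al) / INR ga)
       * Gamma ((INR w0 + INR b0) / INR ga)
       * Gamma (INR w0 / INR al + INR s)
       / (Gamma ((INR w0 + INR b0 + INR s * INR al) / INR ga)
          * Gamma (INR n + (INR w0 + INR b0) / INR ga)
          * Gamma (INR w0 / INR al)))
  /\
  (* asymptotics, b0 = b n with min(n, b n) -> oo *)
  (forall b : nat -> nat, is_lim_seq (fun n => INR (b n)) p_infty ->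
     let a := INR w0 / INR al in
     let Xhat := fun x => x - INR w0 / INR al in
     (forall s : nat, (1 <= s)%nat ->
        exists eps : nat -> R, is_lim_seq eps 0 /\
          exists N : nat, forall n : nat, (N <= n)%nat ->
            urn_expect w0 (b n) al ga n (fun x => falling (Xhat x) s) =
              lam al ga n (b n) ^ s * (Gamma (a + INR s) / Gamma a) * (1 + eps n))
     /\
     (* (i) *)
     (is_lim_seq (fun n => lam al ga n (b n)) p_infty ->
        conv_in_dist (fun n => urn_cdf w0 (b n) al ga n
                                 (fun x => Xhat x / lam al ga n (b n)))
                     (gamma_cdf a)
        /\ forall s : nat, exists m : R,
             is_RInt_gen (fun x => x ^ s * gamma_density a x)
                         (at_right 0) (Rbar_locally p_infty) m
             /\ is_lim_seq (fun n => urn_expect w0 (b n) al ga n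
                                      (fun x => (Xhat x / lam al ga n (b n)) ^ s)) m)
     /\
     (* (ii) *)
     (forall rho : R, 0 < rho ->
        is_lim_seq (fun n => lam al ga n (b n)) rho ->
        conv_in_dist (fun n => urn_cdf w0 (b n) al ga n Xhat) (mpo_cdf a rho)
        /\ forall s : nat, exists m : R,
             is_series (fun l => INR l ^ s * mpo_pmf a rho l) m
             /\ is_lim_seq (fun n => urn_expect w0 (b n) al ga n
                                      (fun x => (Xhat x) ^ s)) m)).
Proof.
  pose proof (white_share_pos w0 al Hal Hw0) as Ha.
  split.
  { intros b0 n s _. apply urn_expect_rising; lia. }
  intros b Hb a Xhat.
  assert (HX : forall k, Xhat (Xval w0 al k) = INR k).
  { intros k. unfold Xhat. rewrite Xval_eq by assumption. ring. }
  split; [|split].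
  - intros s _. now apply urn_expect_falling_asymp with be.
  - intros Hl. split.
    + intros x Hx.
      apply is_lim_seq_ext with (2 := scaled_cdf_cvg al be ga w0 b Hal Hw0 Hga Hb Hl x Hx).
      intros n. apply draws_expect_ext. intros k. now rewrite HX.
    + intros s. exists (rising a s). split; [now apply is_RInt_gen_gamma_moment|].
      apply is_lim_seq_ext with
        (2 := draws_moment_scaled_lim al be ga w0 b s Hal Hw0 Hga Hb Hl).
      intros n. apply draws_expect_ext. intros k. now rewrite HX.
  - intros rho Hrho Hl. split.
    + intros x _. now apply urn_cdf_cvg_mpo with be.
    + intros s. eexists. split; [now apply mpo_moment|].
      apply is_lim_seq_ext with
        (2 := draws_moment_lim al be ga w0 b rho s Hal Hw0 Hga Hb Hrho Hl).
      intros n. apply draws_expect_ext. intros k. now rewrite HX.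
Qed.
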